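(* Let $0<q<1$ and let $(X^k(n))$, $k\ge1$, $n\in\frac12\mathbb N$, be the interacting particle system defined in the context, started from $X^k_i(0)=0$ for all $k,i$. For each $k\ge1$, the random process $\big(X^k(n-\tfrac12),X^k(n)\big)_{n\in\mathbb N}$ is a Markov process with transition kernel given by $S_k$. Furthermore, $(X^k(n))_{n\in\mathbb N}$ is a Markov process with transition kernel given by $P_k$.
   Context: $\mathbb N=\{0,1,2,\dots\}$. For $k\ge1$, with $r=\lfloor\frac{k+1}{2}\rfloor$, let $\mathcal W_k=\{(\lambda_1\ge\dots\ge\lambda_r):\lambda_i\in\mathbb N\}$. If $\lambda=(\lambda_1\ge\dots\ge\lambda_r)$ and $\mu=(\mu_1\ge\dots\ge\mu_r)$ or $\mu=(\mu_1\ge\dots\ge\mu_{r+1})$, write $\lambda\prec\mu$ if $\mu_{i+1}\le\lambda_i$ and $\lambda_i\le\mu_i$ for all values of $i$ for which these make sense; $c\prec\lambda,\beta$ means $c\prec\lambda$ and $c\prec\beta$. Dynamics. Write $\{x\}=x$ for integers $x\ge0$ and $\{x\}=-x-1$ for integers $x<0$. Let $\xi_i^k(n+\frac12)$ and $\xi_i^k(n+1)$, for $n\in\mathbb N$, $k\ge1$, $1\le i\le\lfloor\frac{k+1}2\rfloor$, be i.i.d. geometric random variables with parameter $q$: $\mathbb P(\xi=x)=(1-q)q^x$, $x\in\mathbb N$. Level $k$ carries $\lfloor\frac{k+1}2\rfloor$ particles with positions $X^k(n)=(X_1^k(n)\ge X^k_2(n)\ge\dots\ge0)\in\mathcal W_k$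 at time $n\in\frac12\mathbb N$. Initially all $X_i^k(0)=0$. Terms $X^{k-1}_0$ are interpreted as $+\infty$. For $n\in\mathbb N$, the configuration at time $n+\frac12$ is obtained, level by level, from $$X^k_{(k+1)/2}(n+\tfrac12)=\min\big(X^k_{(k+1)/2}(n),\,X^{k-1}_{(k-1)/2}(n+\tfrac12)\big)\quad(k\text{ odd}),$$ and for all other particles $$X_i^k(n+\tfrac12)=\max\big(X_i^{k-1}(n),\ \min(X_i^k(n),X_{i-1}^{k-1}(n+\tfrac12))-\xi_i^k(n+\tfrac12)\big).$$ The configuration at time $n+1$ is obtained from $$X^k_{(k+1)/2}(n+1)=\min\big(\{X^k_{(k+1)/2}(n+\tfrac12)+\xi^k_{(k+1)/2}(n+1)-\xi^k_{(k+1)/2}(n+\tfrac12)\},\ X^{k-1}_{(k-1)/2}(n+\tfrac12)\big)\quad(k\text{ odd}),$$ and for all other particles $$X_i^k(n+1)=\min\big(X_{i-1}^{k-1}(n+\tfrac12),\ \max(X_i^k(n+\tfrac12),X_i^{k-1}(n+1))+\xi_i^k(n+1)\big).$$ Convention: $X^k(-\frac12)=0$ (the kernel $S_k$ below does not depend on this component). For $\lambda\in\mathcal W_k$ with $k=2r$ or $k=2r-1$, let $l_i=\lambda_i+(r-i)+1$, $m_i=(r-i)+1$, $l_i'=l_i-\frac12$, $m_i'=m_i-\frac12$ ($1\le i\le r$), and $$s_{2r}(\lambda)=\prod_{1\le i<j\le r}\frac{l_i^2-l_j^2}{m_i^2-m_j^2}\prod_{1\le i\le r}\frac{l_i}{m_i},\qquad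 s_{2r-1}(\lambda)=\prod_{1\le i<j\le r}\frac{l_i'^2-l_j'^2}{m_i'^2-m_j'^2}.$$ For $x,y\in\mathbb N$ let $R(x,y)=\frac{1-q}{1+q}\left(q^{|x-y|}+q^{x+y+1}\right)$. Kernels $S_k$. For every $k\ge1$ the state space is $\mathcal W_k^{(2)}=\{(z,y)\in\mathcal W_k\times\mathcal W_k:z\prec y\}$. If $k=2r$, $$S_k((z,y),(z',y'))=(1-q)^k\frac{s_k(y')}{s_k(y)}q^{\sum_{i=1}^r(y_i+y_i'-2z_i')}1_{z'\prec y,y'}.$$ If $k=2r-1$, $$S_k((z,y),(z',y'))=(1-q)^{k-1}\frac{s_k(y')}{s_k(y)}R(y_r,y_r')\,q^{\sum_{i=1}^{r-1}(y_i+y_i'-2z_i')}\,1_{z'_r=y_r}\,1_{z'\prec y,y'}.$$ Kernels $P_k$ on $\mathcal W_k$: $$P_{2r+1}(\lambda,\beta)=\sum_{c\in\mathbb N^r,\ c\prec\lambda,\beta}(1-q)^{2r}\frac{s_{2r+1}(\beta)}{s_{2r+1}(\lambda)}q^{\sum_{i=1}^r(\lambda_i+\beta_i-2c_i)}R(\lambda_{r+1},\beta_{r+1})\quad(r\ge0),$$ $$P_{2r}(\lambda,\beta)=\sum_{c\in\mathbb N^r,\ c\prec\lambda,\beta}(1-q)^{2r}\frac{s_{2r}(\beta)}{s_{2r}(\lambda)}q^{\sum_{i=1}^r(\lambda_i+\beta_i-2c_i)}\quad(r\ge1),$$ where $c=(c_1\ge\dots\ge c_r)$ and for $r=0$ the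 sum has the single empty term, so $P_1=R$.
   Formalization: For odd k=2r-1 the S_k claim is false as written (k=1 can step from 1 to 0, violating z'≺y'); here the last coordinate of z is X^k_r(n-1), not X^k_r(n-1/2), and z≺y is required only of z_1..z_{r-1}. Even k and all P_k are unchanged. *)

(* Defs.v *)
From mathcomp Require Import all_boot all_order all_algebra.
From mathcomp Require Import all_classical all_reals all_analysis.
Set Implicit Arguments.
Unset Strict Implicit.
Unset Printing Implicit Defensive.
Import Order.TTheory GRing.Theory Num.Theory.
Local Open Scope classical_set_scope.
Local Open Scope ring_scope.

(** Conventions.  Particle and coordinate indices are 0-based: index [i] here is
    [i+1] in the usual notation.  The half-integer time [m/2] is encoded by
    [m : nat], so [2n+1] is time [n+1/2] and [2n+2] is time [n+1]. *)

(* Number of particles on level k, floor((k+1)/2). *)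
Definition parts (k : nat) : nat := (k.+1)./2.

(* W_k is [weyl] on tuples of size [parts k]. *)
Definition weyl (k : nat) : set ((parts k).-tuple nat) :=
  [set l | sorted geq l].

(* lambda \prec mu; used when mu has as many parts as lambda, or one more. *)
Definition interlace (l m : seq nat) : bool :=
  [forall i : 'I_(size l), (nth 0 l i <= nth 0 m i)%N] &&
  [forall i : 'I_(size l),
     (i.+1 < size m)%N ==> (nth 0 m i.+1 <= nth 0 l i)%N].

Section Dynamics.
Local Open Scope nat_scope.

(* {x}: [Negz n] is the integer -n-1, so {Negz n} = n. *)
Definition reflect_int (x : int) : nat :=
  match x with Posz n => n | Negz n => n end.

(* min(x, u_{i-1}), where the entry to the left of the first one is +oo. *)
Definition cap (u : nat -> nat) (i x : nat) : nat :=
  if i is j.+1 then minn x (u j) else x.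

(* The last particle of an odd level; k./2 = (k-1)/2 is its 0-based index. *)
Definition boundary (k i : nat) : bool := odd k && (i == k./2).

(* In both steps, only the entries with 1 <= k and i < parts k are meaningful;
   these never read any other entry.  [X], [H] are the current positions and
   [x], [xh], [x1] the jumps, as functions of the level and of the index.  The
   truncated subtraction is harmless since it is under a max with a natural. *)
Fixpoint half_step (X x : nat -> nat -> nat) (k i : nat) : nat :=
  if k is k'.+1 then
    if boundary k i then cap (half_step X x k') i (X k i)
    else maxn (X k' i) (cap (half_step X x k') i (X k i) - x k i)
  else 0.

Fixpoint full_step (H xh x1 : nat -> nat -> nat) (k i : nat) : nat :=
  if k is k'.+1 then
    if boundary k i then
      cap (H k') i
        (reflect_int (Posz (H k i) + Posz (x1 k i) - Posz (xh k i))%R)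
    else cap (H k') i (maxn (H k i) (full_step H xh x1 k' i) + x1 k i)
  else 0.

(* [position xi m k i] is X^k_{i+1}(m/2), [xi m k i] being xi^k_{i+1}(m/2). *)
Fixpoint position (xi : nat -> nat -> nat -> nat) (m : nat) : nat -> nat -> nat :=
  if m is m'.+1 then
    if odd m then half_step (position xi m') (xi m)
    else full_step (position xi m') (xi m') (xi m)
  else fun _ _ => 0.

Definition level (xi : nat -> nat -> nat -> nat) (k n : nat) :
    (parts k).-tuple nat :=
  [tuple position xi n.*2 k i | i < parts k].

(* First component of the pair process at time n: X^k(n-1/2), and 0 if n = 0.
   S_k carries the factor 1_{z'_r = y_r} when k = 2r-1, so it describes the
   process in which the last coordinate of z is the position of the boundary
   particle before the step, X^k_r(n-1); the intermediate X^k_r(n-1/2) may be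
   smaller, as that particle can be pushed, but no other level ever reads it. *)
Definition half_level (xi : nat -> nat -> nat -> nat) (k n : nat) :
    (parts k).-tuple nat :=
  [tuple (if n is n'.+1 then
            if boundary k i then position xi n'.*2 k i
            else position xi n'.*2.+1 k i
          else 0) | i < parts k].

End Dynamics.

(* W_k^(2).  For k = 2r-1 the coordinate z_r is only bookkeeping (see
   [half_level]) and does not enter the interlacing: X^k_r can decrease, so
   z_r <= y_r would fail.  For k even, [take k./2 z] is z. *)
Definition weyl2 (k : nat) :
    set ((parts k).-tuple nat * (parts k).-tuple nat) :=
  [set zy | [/\ weyl zy.1, weyl zy.2 & interlace (take k./2 zy.1) zy.2]].

Section Kernels.
Variables (R : realType) (q : R).

Definition sdim (k : nat) (lam : seq nat) : R :=
  let r := parts k in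
  let h : R := if odd k then 2^-1 else 0 in
  let l i : R := (nth 0%N lam i + (r - i))%:R - h in
  let m i : R := (r - i)%:R - h in
  (\prod_(i < r) \prod_(j < r | (i < j)%N)
     ((l i ^+ 2 - l j ^+ 2) / (m i ^+ 2 - m j ^+ 2))) *
  (if odd k then 1 else \prod_(i < r) (l i / m i)).

Definition Rker (x y : nat) : R :=
  (1 - q) / (1 + q) * (q ^+ `|Posz x - Posz y|%N + q ^+ (x + y).+1).

(* Common factor of S_k and P_k.  Here k = 2h or k = 2h+1 with h = k./2.  The
   exponent is only used when c interlaces with l and b, where it is not
   truncated. *)
Definition weight (k : nat) (l b c : seq nat) : R :=
  (1 - q) ^+ (k./2).*2 * (sdim k b / sdim k l) *
  q ^+ (\sum_(i < k./2) (nth 0 l i + nth 0 b i - 2 * nth 0 c i))%N *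
  (if odd k then Rker (nth 0%N l k./2) (nth 0%N b k./2) else 1).

Definition Sker (k : nat)
    (zy zy' : (parts k).-tuple nat * (parts k).-tuple nat) : R :=
  let: (y, (z', y')) := (zy.2, zy') in
  let c := take k./2 z' in
  weight k y y' c *
  (odd k ==> (nth 0%N z' k./2 == nth 0%N y k./2))%:R *
  (interlace c y && interlace c y')%:R.

Definition Pker (k : nat) (l b : (parts k).-tuple nat) : R :=
  \sum_(c \in [set c : (k./2).-tuple nat |
          [/\ sorted geq c, interlace c l & interlace c b]])
    weight k l b c.

End Kernels.

Section Probability.
Context {d : measure_display} {Omega : measurableType d} {R : realType}.
Variable P : probability Omega R.

Definition independent_family (I : eqType) (D : set I)
    (X : I -> {RV P >-> nat}) : Prop :=
  forall (J : seq I) (B : I -> set nat),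
    uniq J -> (forall j, j \in J -> D j) ->
    P [set w | forall j, j \in J -> B j (X j w)] =
    (\prod_(j <- J) P (X j @^-1` B j))%E.

Definition iid_geometric (q : R) (xi : nat -> nat -> nat -> {RV P >-> nat}) :
    Prop :=
  let D : set (nat * nat * nat) :=
    [set t | [/\ (0 < t.1.1)%N, (0 < t.1.2)%N & (t.2 < parts t.1.2)%N]] in
  independent_family D (fun t => xi t.1.1 t.1.2 t.2) /\
  forall t, D t -> forall x : nat,
    P [set w | xi t.1.1 t.1.2 t.2 w = x] = ((1 - q) * q ^+ x)%:E.

Definition transition_kernel (T : choiceType) (E : set T) (K : T -> T -> R) :
    Prop :=
  (forall x y, E x -> E y -> 0 <= K x y) /\
  (forall x, E x -> (\esum_(y in E) (K x y)%:E)%E = 1%E).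

(* Markov process with countable state space E: the conditional probability
   that Z_{n+1} = x_{n+1}, given Z_0 = x_0, ..., Z_n = x_n, is K(x_n, x_{n+1})
   (multiplied out by the probability of the conditioning event). *)
Definition markov_process (T : countType) (E : set T) (K : T -> T -> R)
    (Z : nat -> Omega -> T) : Prop :=
  [/\ transition_kernel E K,
      forall n w, E (Z n w),
      forall n x, measurable (Z n @^-1` [set x]) &
      forall (n : nat) (x : nat -> T), (forall m, E (x m)) ->
        P [set w | forall m, (m <= n.+1)%N -> Z m w = x m] =
        (P [set w | forall m, (m <= n)%N -> Z m w = x m] *
         (K (x n) (x n.+1))%:E)%E].

End Probability.

(* Main.v *)
Require Import Defs.
From mathcomp Require Import all_boot all_order all_algebra.
From mathcomp Require Import all_fingroup zify ring lra.
From mathcomp Require Import all_classical all_reals all_analysis.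
Set Implicit Arguments.
Unset Strict Implicit.
Unset Printing Implicit Defensive.
Import Order.TTheory GRing.Theory Num.Theory.
Local Open Scope classical_set_scope.
Local Open Scope ring_scope.

(** The dimensions s_k enter only through the branching rule
    s_k(y) = sum over x \prec y of s_(k-1)(x), which follows from a determinant
    formula for s_k.  Let W_k(y; z', y') be S_k((z, y), (z', y')) with the ratio
    s_k(y') / s_k(y) removed, and let Q_k be the conditional law of the update of
    level k given that of level k-1.  The heart of the proof is the identity

      sum over x \prec y and z of
        W_(k-1)(x; z, x') Q_k(x, z, x', y; z', y') = W_k(y; z', y') 1_(x' \prec y').

    Both the summand and the right-hand side factor over the particles, because
    Q_k involves z_(i-1) only through the i-th particle; so the identity reduces
    to telescoping sums in one variable.  It is an intertwining: given the
    history of level k up to time n, with X^k(n) = y, the law of X^(k-1)(n) is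
    s_(k-1)(x) / s_k(y) on x \prec y, and induction on n and k gives the product
    formula for the histories of level k.  The rows of S_k and P_k sum to 1
    because every state is reached with positive probability and the total mass
    of a history is preserved. *)

(** * Independence of discrete random variables *)

(** The obstacle is that level k+1 is not autonomous: its update reads the rows x, z, x' of level k
    at times n, n+1/2 and n+1. This is why histories record the pairs (z, y) and not y alone: once
    the lower history is frozen, the upper one is a function of the jumps of level k+1 only, hence
    independent of the lower one.

    The sums telescope because a geometric law stopped at a wall loses its factor 1 - q exactly at
    the wall: elsewhere (1 - q) q^m is a difference of consecutive powers, and the atom at the wall
    supplies the missing end term. The boundary particle obeys the same mechanism, since R(x, y) is
    geometric in x for x >= y.

    Conditional probabilities are always multiplied out by the probability of the conditioning
    event, so null histories need no separate theory. Interlacing bounds every coordinate of the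
    lower configurations, so the sums over them are finite and infinite sums appear only in the row
    sums of the kernels. *)

Section DiscreteProbability.
Context {d : measure_display} {Omega : measurableType d} {R : realType}.
Variable P : probability Omega R.

Definition Pr (E : set Omega) : R := fine (P E).

Lemma PrE (E : set Omega) : measurable E -> P E = (Pr E)%:E.
Proof. by move=> mE; rewrite /Pr fineK// fin_num_measure. Qed.

Lemma Pr_ge0 (E : set Omega) : 0 <= Pr E.
Proof. exact: fine_ge0. Qed.

Lemma Pr0 : Pr set0 = 0. Proof. by rewrite /Pr measure0. Qed.

Lemma PrT : Pr setT = 1. Proof. by rewrite /Pr probability_setT. Qed.

Lemma eq_Pr (E F : set Omega) : (forall w, E w <-> F w) -> Pr E = Pr F.
Proof.
by move=> EF; congr Pr; apply/seteqP; split=> w /EF.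
Qed.

Lemma PrDI (A B : set Omega) : measurable A -> measurable B ->
  Pr A = Pr (A `\` B) + Pr (A `&` B).
Proof.
move=> mA mB; apply: EFin_inj.
rewrite EFinD -!PrE//; first exact: measureDI.
- exact: measurableI.
- exact: measurableD.
Qed.

Definition discrete (T : Type) (V : Omega -> T) :=
  forall v, measurable [set w | V w = v].

Lemma prob_partition (V : Omega -> nat) (E : set Omega) :
  discrete V -> measurable E ->
  P E = (\sum_(n <oo) P (E `&` [set w | V w = n]))%E.
Proof.
move=> mV mE; have -> : E = \bigcup_n (E `&` [set w | V w = n]).
  apply/seteqP; split=> [w Ew|w [n _ []]//]; by exists (V w).
rewrite measure_bigcup.
- rewrite (@eq_eseriesl _ _ xpredT) => [|n]; last by rewrite in_setT.
  apply: eq_eseriesr => n _; congr (P _); apply/seteqP; split=> w /=.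
    by move=> [Ew <-]; split => //; exists (V w).
  by move=> [[? _ [Ew _]] ?].
- by move=> n _; apply: measurableI.
- by move=> i j _ _ [w [[_ /= <-] [_ /= <-]]].
Qed.

Lemma discrete_pickle (T : countType) (V : Omega -> T) :
  discrete V -> discrete (pickle \o V).
Proof.
move=> mV n; case: (pselect (exists v, @pickle T v = n)) => [[v vn]|nv].
  rewrite (_ : mkset _ = [set w | V w = v]); first exact: mV.
  apply/seteqP; split=> w /=; last by move=> ->.
  by rewrite -vn => /(pcan_inj pickleK).
rewrite (_ : mkset _ = set0) //; apply/seteqP; split=> w //= Vn.
by apply: nv; exists (V w).
Qed.

Lemma discrete_preimage (T : countType) (V : Omega -> T) (Q : T -> Prop) :
  discrete V -> measurable [set w | Q (V w)].
Proof.
move=> mV; pose F v := if pselect (Q v) then [set w | V w = v] else set0.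
rewrite (_ : mkset _ = \bigcup_v F v).
  apply: countable_bigcupT_measurable; first exact: countableP.
  by move=> v; rewrite /F; case: pselect => Qv; [exact: mV|exact: measurable0].
apply/seteqP; split=> w /=; first by exists (V w) => //; rewrite /F; case: pselect.
by move=> [v _]; rewrite /F; case: pselect => //= Qv ->.
Qed.

(** Conditioning without division: a proportionality between two events may be checked on each atom
    of a countable-valued variable, such as a whole history. *)
Lemma Pr_scale (T : countType) (V : Omega -> T) (E F : set Omega) (c : R) :
  discrete V -> measurable E -> measurable F ->
  (forall v, Pr (E `&` [set w | V w = v]) = c * Pr (F `&` [set w | V w = v])) ->
  Pr E = c * Pr F.
Proof.
move=> mV mE mF EF; have mV' := discrete_pickle mV.
apply: EFin_inj; rewrite EFinM -!PrE// (prob_partition mV' mE) (prob_partition mV' mF).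
rewrite -nneseriesZl//; apply: eq_eseriesr => n _.
case: (pselect (exists v, @pickle T v = n)) => [[v vn]|nv].
  have -> : [set w | (pickle \o V) w = n] = [set w | V w = v].
    apply/seteqP; split=> w /=; last by move=> ->.
    by rewrite -vn => /(pcan_inj pickleK).
  by rewrite !PrE ?EF//; apply: measurableI.
have -> : [set w | (pickle \o V) w = n] = set0.
  apply/seteqP; split=> w //= Vn; by apply: nv; exists (V w).
by rewrite !setI0 measure0 mule0.
Qed.

Lemma prob_partition_esum (T : countType) (V : Omega -> T) (E : set Omega) :
  discrete V -> measurable E ->
  P E = (\esum_(v in [set: T]) P (E `&` [set w | V w = v]))%E.
Proof.
move=> mV mE; have mV' := discrete_pickle mV.
rewrite (prob_partition mV' mE) nneseries_esumT//.
pose G n := P (E `&` [set w | pickle (V w) = n]).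
transitivity (\esum_(n in [set @pickle T v | v in setT]) G n)%E.
  rewrite [RHS]esum_mkcond; apply: eq_esum => n _.
  case: ifPn => // /negP nv; rewrite (_ : _ `&` _ = set0) ?measure0//.
  apply/seteqP; split=> w //= [_ Vn]; apply: nv.
  by apply/mem_set; exists (V w).
rewrite esum_image; last by move=> x y _ _; apply: (pcan_inj pickleK).
apply: eq_esum => v _; congr (P (_ `&` _)).
by apply/seteqP; split=> w /=; [move/(pcan_inj pickleK)|move=> ->].
Qed.

Lemma Pr_finite_partition (T : eqType) (V : Omega -> T) (s : seq T) (E : set Omega) :
  discrete V -> measurable E -> uniq s -> (forall w, E w -> V w \in s) ->
  Pr E = \sum_(v <- s) Pr (E `&` [set w | V w = v]).
Proof.
move=> mV; elim: s E => [|v s IH] E mE /= => [_ Es|/andP[vs us] Es].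
  by rewrite big_nil (_ : E = set0) ?Pr0//; apply/seteqP; split=> w // /Es.
rewrite big_cons (PrDI mE (mV v)) addrC; congr (_ + _).
rewrite IH//.
- apply: eq_big_seq => u us'; apply: eq_Pr => w /=; split=> [[[]]//|[Ew wu]].
  by do 2![split=> //]; rewrite wu => uv; rewrite -uv us' in vs.
- exact: measurableD.
- by move=> w [/Es]; rewrite inE => /orP[/eqP e|//] /(_ e).
Qed.

(** Independence passes from atoms to arbitrary events by summing over one variable at a time with
    [Pr_scale]. *)
Lemma Pr_indep (T1 T2 : countType) (V1 : Omega -> T1) (V2 : Omega -> T2)
    (Q1 : T1 -> Prop) (Q2 : T2 -> Prop) :
  discrete V1 -> discrete V2 ->
  (forall v1 v2, Pr [set w | V1 w = v1 /\ V2 w = v2] =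
                 Pr [set w | V1 w = v1] * Pr [set w | V2 w = v2]) ->
  Pr [set w | Q1 (V1 w) /\ Q2 (V2 w)] =
  Pr [set w | Q1 (V1 w)] * Pr [set w | Q2 (V2 w)].
Proof.
move=> m1 m2 ind.
have mQ1 := discrete_preimage Q1 m1; have mQ2 := discrete_preimage Q2 m2.
have step v1 : Pr [set w | V1 w = v1 /\ Q2 (V2 w)] =
    Pr [set w | V1 w = v1] * Pr [set w | Q2 (V2 w)].
  apply: (Pr_scale m2) => //; first exact: (measurableI _ _ (m1 v1) mQ2).
  move=> v2; case: (pselect (Q2 v2)) => Qv.
    rewrite (@eq_Pr _ [set w | V1 w = v1 /\ V2 w = v2]) ?ind; last first.
      by move=> w /=; split=> [[[]]//|[-> e]]; rewrite e.
    congr (_ * _); apply: eq_Pr => w /=; split=> [->//|[]//].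
  rewrite (@eq_Pr _ set0) ?(@eq_Pr ([set w | Q2 _] `&` _) set0) ?Pr0 ?mulr0//.
    by move=> w /=; split=> // -[] + e; rewrite e.
  by move=> w /=; split=> // -[[_ +] e]; rewrite e.
rewrite mulrC; apply: (Pr_scale m1) => //; first exact: (measurableI _ _ mQ1 mQ2).
move=> v1; case: (pselect (Q1 v1)) => Qv.
  rewrite (@eq_Pr _ [set w | V1 w = v1 /\ Q2 (V2 w)]) ?step; last first.
    by move=> w /=; split=> [[[]]//|[e]]; rewrite e.
  rewrite mulrC; congr (_ * _); apply: eq_Pr => w /=; split=> [e|[]//].
  by rewrite e.
rewrite (@eq_Pr _ set0) ?(@eq_Pr ([set w | Q1 _] `&` _) set0) ?Pr0 ?mulr0//.
  by move=> w /=; split=> // -[] + e; rewrite e.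
by move=> w /=; split=> // -[[+ _] e]; rewrite e.
Qed.

End DiscreteProbability.

(** * Functions of finitely many jumps *)

Local Notation jumps := (nat -> nat -> nat -> nat) (only parsing).

Definition agree (A : pred (nat * nat * nat)) (a b : jumps) :=
  forall m j i, A (m, j, i) -> a m j i = b m j i.

(** Stands in for measurability with respect to the jumps indexed by [A]. *)
Definition depends (T : Type) (A : pred (nat * nat * nat)) (f : jumps -> T) :=
  forall a b, agree A a b -> f a = f b.

Lemma depends_sub (T : Type) (A B : pred (nat * nat * nat)) (f : jumps -> T) :
  (forall t, A t -> B t) -> depends A f -> depends B f.
Proof. by move=> AB fA a b ab; apply: fA => m j i /AB; apply: ab. Qed.

(** A finite list, because [independent_family] quantifies over lists of indices. *)
Definition idx (A : pred (nat * nat * nat)) (N : nat) : seq (nat * nat * nat) :=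
  [seq t <- [seq (u, i) | u <- [seq (m, j) | m <- iota 0 N, j <- iota 0 N],
                          i <- iota 0 N] | A t].

Lemma idx_uniq A N : uniq (idx A N).
Proof.
apply: filter_uniq; apply: allpairs_uniq; rewrite ?iota_uniq//.
  by apply: allpairs_uniq; rewrite ?iota_uniq//; move=> [? ?] [? ?] _ _ [-> ->].
by move=> [? ?] [? ?] _ _ [-> ->].
Qed.

Lemma mem_idx A N m j i :
  (m, j, i) \in idx A N = [&& A (m, j, i), (m < N)%N, (j < N)%N & (i < N)%N].
Proof.
rewrite mem_filter; congr (_ && _); apply/allpairsP/idP => /=.
  move=> [[[? ?] ?]] /= [/allpairsP[[? ?]] /= [+ + [-> ->]] + [-> -> ->]].
  by rewrite !mem_iota /= !add0n => -> -> ->.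
move=> /and3P[mN jN iN]; exists (m, j, i); rewrite mem_iota; split=> //.
by apply/allpairsP; exists (m, j); rewrite !mem_iota.
Qed.

Section Independence.
Context {d : measure_display} {Omega : measurableType d} {R : realType}.
Variable P : probability Omega R.
Variable xi : nat -> nat -> nat -> {RV P >-> nat}.

Definition sample (w : Omega) : jumps := fun m j i => xi m j i w.

Definition noise_on (J : seq (nat * nat * nat)) (w : Omega) : seq nat :=
  [seq xi t.1.1 t.1.2 t.2 w | t <- J].

Lemma discrete_xi m j i : discrete (xi m j i).
Proof.
by move=> v; have := measurable_funPTI (xi m j i) (Y := [set v]) I.
Qed.

Lemma discrete_noise_on J : discrete (noise_on J).
Proof.
elim: J => [|t J IH] [|x v] /=; rewrite /noise_on /=.
- by rewrite (_ : mkset _ = setT)//; apply/seteqP; split.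
- by rewrite (_ : mkset _ = set0)//; apply/seteqP; split.
- by rewrite (_ : mkset _ = set0)//; apply/seteqP; split.
rewrite (_ : mkset _ = [set w | xi t.1.1 t.1.2 t.2 w = x] `&` [set w | noise_on J w = v]).
  by apply: measurableI; [exact: discrete_xi|exact: IH].
by apply/seteqP; split=> w /= [<- <-].
Qed.

(** Rebuilds an array of jumps from the recorded values; an index outside [J] falls off the end of
    the list and gets 0. *)
Definition noise_of (J : seq (nat * nat * nat)) (s : seq nat) : jumps :=
  fun m j i => nth 0%N s (index (m, j, i) J).

(** A function of finitely many jumps factors through a variable with values in [seq nat], a
    countable type; discreteness and independence are inherited from there. *)
Lemma depends_noise_on (T : Type) (A : pred (nat * nat * nat)) N (f : jumps -> T) :
  (forall t, A t -> [&& t.1.1 < N, t.1.2 < N & t.2 < N]%N) -> depends A f ->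
  forall w, f (sample w) = f (noise_of (idx A N) (noise_on (idx A N) w)).
Proof.
move=> AN fA w; apply: fA => m j i Ai; rewrite /noise_of /noise_on.
have mi : (m, j, i) \in idx A N by rewrite mem_idx Ai; exact: (AN _ Ai).
by rewrite (nth_map (0, 0, 0)%N) ?index_mem// nth_index.
Qed.

Lemma depends_discrete (T : countType) (A : pred (nat * nat * nat)) N (f : jumps -> T) :
  (forall t, A t -> [&& t.1.1 < N, t.1.2 < N & t.2 < N]%N) -> depends A f ->
  discrete (fun w => f (sample w)).
Proof.
move=> AN fA v.
under eq_set do rewrite (depends_noise_on AN fA).
exact: (@discrete_preimage _ _ _ _ (fun s => f (noise_of (idx A N) s) = v)
         (@discrete_noise_on (idx A N))).
Qed.

Lemma depends_measurable (A : pred (nat * nat * nat)) N (f : jumps -> Prop) :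
  (forall t, A t -> [&& t.1.1 < N, t.1.2 < N & t.2 < N]%N) -> depends A f ->
  measurable [set w | f (sample w)].
Proof.
move=> AN fA.
under eq_set do rewrite (depends_noise_on AN fA).
exact: (@discrete_preimage _ _ _ _ (fun s => f (noise_of (idx A N) s))
         (@discrete_noise_on (idx A N))).
Qed.

Let D : set (nat * nat * nat) :=
  [set t | [/\ (0 < t.1.1)%N, (0 < t.1.2)%N & (t.2 < parts t.1.2)%N]].

Hypothesis indep : independent_family D (fun t => xi t.1.1 t.1.2 t.2).

Lemma Pr_noise_on J v : uniq J -> (forall t, t \in J -> D t) -> size v = size J ->
  Pr P [set w | noise_on J w = v] =
  \prod_(t <- J) Pr P [set w | xi t.1.1 t.1.2 t.2 w = nth 0%N v (index t J)].
Proof.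
move=> uJ JD sv.
have := indep (fun t => [set nth 0%N v (index t J)]) uJ JD.
rewrite (_ : mkset _ = [set w | noise_on J w = v]); last first.
  apply/seteqP; split=> w /=.
    move=> H; apply: (@eq_from_nth _ 0%N); rewrite size_map ?sv// => i iJ.
    by rewrite (nth_map (0, 0, 0)%N)// H ?mem_nth// index_uniq.
  by move=> <- t tJ; rewrite (nth_map (0, 0, 0)%N) ?index_mem// nth_index.
rewrite PrE; last exact: discrete_noise_on.
rewrite (eq_bigr (fun t => (Pr P [set w | xi t.1.1 t.1.2 t.2 w = nth 0%N v (index t J)])%:E)); last first.
  by move=> t _; rewrite -PrE//; exact: discrete_xi.
by rewrite prodEFin => H; apply: EFin_inj.
Qed.

Lemma Pr_depends (A1 A2 : pred (nat * nat * nat)) N (f1 f2 : jumps -> Prop) :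
  (forall t, A1 t -> D t) -> (forall t, A2 t -> D t) ->
  (forall t, A1 t -> [&& t.1.1 < N, t.1.2 < N & t.2 < N]%N) ->
  (forall t, A2 t -> [&& t.1.1 < N, t.1.2 < N & t.2 < N]%N) ->
  (forall t, A1 t -> ~~ A2 t) ->
  depends A1 f1 -> depends A2 f2 ->
  Pr P [set w | f1 (sample w) /\ f2 (sample w)] =
  Pr P [set w | f1 (sample w)] * Pr P [set w | f2 (sample w)].
Proof.
move=> D1 D2 N1 N2 A12 fA1 fA2; set J1 := idx A1 N; set J2 := idx A2 N.
under eq_set do rewrite (depends_noise_on N1 fA1) (depends_noise_on N2 fA2).
under [X in _ = Pr _ X * _]eq_set do rewrite (depends_noise_on N1 fA1).
under [X in _ = _ * Pr _ X]eq_set do rewrite (depends_noise_on N2 fA2).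
apply: (@Pr_indep _ _ _ _ _ _ _ _ (fun s => f1 (noise_of J1 s)) (fun s => f2 (noise_of J2 s)));
  try exact: discrete_noise_on.
have szn J w : size (noise_on J w) = size J by rewrite size_map.
have J1D t : t \in J1 -> D t by rewrite mem_filter => /andP[/D1].
have J2D t : t \in J2 -> D t by rewrite mem_filter => /andP[/D2].
have u12 : uniq (J1 ++ J2).
  rewrite cat_uniq !idx_uniq andbT /=; apply/hasPn => t.
  by rewrite !mem_filter => /andP[A2t _]; rewrite negb_and (contraL (A12 t)).
move=> v1 v2.
(* A list of the wrong length is never recorded, so both sides vanish. *)
case: (eqVneq (size v1) (size J1)) => [s1|s1]; last first.
  rewrite [in RHS](@eq_Pr _ _ _ _ _ set0) ?Pr0 ?mul0r.
    rewrite (@eq_Pr _ _ _ _ _ set0) ?Pr0// => w /=; split=> // -[e _].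
    by rewrite -e szn eqxx in s1.
  by move=> w /=; split=> // e; rewrite -e szn eqxx in s1.
case: (eqVneq (size v2) (size J2)) => [s2|s2]; last first.
  rewrite [X in _ = _ * X](@eq_Pr _ _ _ _ _ set0) ?Pr0 ?mulr0.
    rewrite (@eq_Pr _ _ _ _ _ set0) ?Pr0// => w /=; split=> // -[_ e].
    by rewrite -e szn eqxx in s2.
  by move=> w /=; split=> // e; rewrite -e szn eqxx in s2.
rewrite !Pr_noise_on ?idx_uniq//.
(* The two blocks together form one duplicate-free list, to which the independence hypothesis
   applies. *)
rewrite (@eq_Pr _ _ _ _ _ [set w | noise_on (J1 ++ J2) w = v1 ++ v2]); last first.
  move=> w /=; rewrite /noise_on map_cat; split=> [[-> ->]//|/eqP].
  by rewrite eqseq_cat ?size_map// => /andP[/eqP -> /eqP ->].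
rewrite Pr_noise_on ?size_cat ?s1 ?s2//; last first.
  by move=> t; rewrite mem_cat => /orP[/J1D|/J2D].
rewrite big_cat /=; congr (_ * _); apply: eq_big_seq => t tJ.
  by rewrite index_cat tJ nth_cat s1 index_mem tJ.
rewrite index_cat; have /negPf -> : t \notin J1.
  by apply: contraL tJ => tJ1; move: u12; rewrite cat_uniq => /and3P[_ /hasPn H _];
    apply: contraTN tJ1 => /H.
by rewrite nth_cat s1 ltnNge leq_addr /= addKn.
Qed.

Lemma Pr_depends_seq (T : eqType) (s : seq T) (A : T -> pred (nat * nat * nat)) N
    (f : T -> jumps -> Prop) :
  uniq s ->
  (forall i t, i \in s -> A i t -> D t) ->
  (forall i t, i \in s -> A i t -> [&& t.1.1 < N, t.1.2 < N & t.2 < N]%N) ->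
  (forall i j t, i \in s -> j \in s -> A i t -> A j t -> i = j) ->
  (forall i, i \in s -> depends (A i) (f i)) ->
  Pr P [set w | forall i, i \in s -> f i (sample w)] =
  \prod_(i <- s) Pr P [set w | f i (sample w)].
Proof.
elim: s => [|i s IH] /= us AD AN A12 fA.
  rewrite big_nil -(PrT P); apply: eq_Pr => w; split=> [_|_ j]; first exact: I.
  by rewrite in_nil.
move: us => /andP[is_ us].
rewrite big_cons -IH//; first last.
- by move=> j js; apply: fA; rewrite inE js orbT.
- by move=> j k t js ks; apply: A12; rewrite inE ?js ?ks orbT.
- by move=> j t js; apply: AN; rewrite inE js orbT.
- by move=> j t js; apply: AD; rewrite inE js orbT.
have iis : i \in i :: s by rewrite inE eqxx.
have sis j : j \in s -> j \in i :: s by rewrite inE orbC => ->.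
(* The remaining blocks are merged into one, so that each step of the induction separates just two
   blocks. *)
pose As t := has (fun j => A j t) s.
rewrite -(@Pr_depends (A i) As N (f i) (fun a => forall j, j \in s -> f j a)).
- apply: eq_Pr => w; split=> [H|[H1 H2] j].
    by split=> [|j js]; apply: H => //; apply: sis.
  by rewrite inE => /orP[/eqP ->//|/H2].
- by move=> t; apply: AD.
- by move=> t /hasP[j js]; apply: AD; rewrite sis.
- by move=> t; apply: AN.
- by move=> t /hasP[j js]; apply: AN; rewrite sis.
- move=> t Ait; apply/hasPn => j js; apply/negP => Ajt; move: is_.
  by have -> := A12 i j t iis (sis _ js) Ait Ajt; rewrite js.
- exact: fA.
- move=> a b ab; apply/propext; split=> H j js.
    rewrite -(fA j (sis _ js) a b); first exact: H.
    by move=> m k l Ajt; apply: ab; apply/hasP; exists j.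
  rewrite (fA j (sis _ js) a b); first exact: H.
  by move=> m k l Ajt; apply: ab; apply/hasP; exists j.
Qed.

End Independence.

(** * Interlacing of the dynamics *)

Section DynamicsTheory.
Local Open Scope nat_scope.

Lemma interlaceP (l m : seq nat) :
  reflect (forall i, i < size l -> nth 0 m i.+1 <= nth 0 l i <= nth 0 m i)
          (interlace l m).
Proof.
apply: (iffP andP) => [[/forallP H1 /forallP H2] i il|H].
  apply/andP; split; last exact: (H1 (Ordinal il)).
  case: (ltnP i.+1 (size m)) => im; last by rewrite nth_default.
  by have /implyP/(_ im) := H2 (Ordinal il).
split; apply/forallP => i; first by case/andP: (H i (ltn_ord i)).
by apply/implyP => _; case/andP: (H i (ltn_ord i)).
Qed.

Lemma interlace_sorted (c y : seq nat) :
  size y <= (size c).+1 -> interlace c y -> sorted geq y.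
Proof.
move=> sy /interlaceP H; apply/(sortedP 0) => i iy.
have /H/andP[H1 H2] : i < size c by rewrite -ltnS (leq_trans iy).
exact: leq_trans H1 H2.
Qed.

Lemma partsS k : parts k.+1 = k./2.+1. Proof. by []. Qed.

Lemma partsE k : parts k = odd k + k./2.
Proof. by rewrite /parts -uphalfE uphalf_half. Qed.

Lemma halfS k : (k.+1)./2 = parts k. Proof. by []. Qed.

(** The jumps that determine levels up to [K] until time M/2. *)
Definition dom (M K : nat) : pred (nat * nat * nat) := fun t =>
  [&& 0 < t.1.1 <= M, 0 < t.1.2 <= K & t.2 < parts t.1.2].

(** Away from the boundary, a site [i] of level k+1 satisfies [i < parts k], so only meaningful
    entries of level k are read. *)
Lemma half_step_ext K (X X' x x' : nat -> nat -> nat) :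
  (forall k i, k <= K -> i < parts k -> X k i = X' k i) ->
  (forall k i, 0 < k <= K -> i < parts k -> x k i = x' k i) ->
  forall k i, k <= K -> i < parts k -> half_step X x k i = half_step X' x' k i.
Proof.
move=> HX Hx; elim=> [//|k IH] i kK ip /=.
have E : cap (half_step X x k) i (X k.+1 i) = cap (half_step X' x' k) i (X' k.+1 i).
  case: i ip => [|j] ip /=; first by rewrite HX.
  by rewrite HX// IH ?(ltnW kK)//; move: ip; rewrite partsS partsE; lia.
rewrite E Hx//; case: ifPn => // nb; rewrite HX ?(ltnW kK)//.
by move: nb ip; rewrite /boundary partsS partsE; lia.
Qed.

Lemma full_step_ext K (X X' x x' u u' : nat -> nat -> nat) :
  (forall k i, k <= K -> i < parts k -> X k i = X' k i) ->
  (forall k i, 0 < k <= K -> i < parts k -> x k i = x' k i) ->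
  (forall k i, 0 < k <= K -> i < parts k -> u k i = u' k i) ->
  forall k i, k <= K -> i < parts k -> full_step X x u k i = full_step X' x' u' k i.
Proof.
move=> HX Hx Hu; elim=> [//|k IH] i kK ip /=.
have E v : cap (X k) i v = cap (X' k) i v.
  case: i ip => [|j] ip //=.
  by rewrite HX ?(ltnW kK)//; move: ip; rewrite partsS partsE; lia.
rewrite !E Hx// Hu// HX//; case: ifPn => // nb; rewrite IH ?(ltnW kK)//.
by move: nb ip; rewrite /boundary partsS partsE; lia.
Qed.

Lemma position_agree M K (a b : jumps) : agree (dom M K) a b ->
  forall m k i, m <= M -> k <= K -> i < parts k -> position a m k i = position b m k i.
Proof.
move=> ab; elim=> [//|m IH] k i mM kK ip /=.
have ext m' : 0 < m' <= M -> forall k i, 0 < k <= K -> i < parts k -> a m' k i = b m' k i.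
  by move=> mM' k' i' kK' ip'; apply: ab; rewrite /dom /= mM' kK' ip'.
case: ifPn => om.
  apply: (half_step_ext (K := K)) => //; first by move=> *; apply: IH => //; apply: ltnW.
  exact: ext.
apply: (full_step_ext (K := K)) => //; first by move=> *; apply: IH => //; apply: ltnW.
  by apply: ext; rewrite (ltnW mM) andbT; case: (m) om => //.
exact: ext.
Qed.

Lemma level_depends k n : depends (dom n.*2 k) (fun a => level a k n).
Proof.
move=> a b ab; apply: eq_from_tnth => i; rewrite !tnth_mktuple.
exact: (position_agree ab).
Qed.

Lemma half_level_depends k n : depends (dom n.*2 k) (fun a => half_level a k n).
Proof.
move=> a b ab; apply: eq_from_tnth => i; rewrite !tnth_mktuple.
case: n ab => [//|n ab]; case: ifP => _; apply: (position_agree ab) => //; lia.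
Qed.

(** The update of one row with its inputs made explicit: [x], [z], [x'] are the lower row at times
    n, n+1/2, n+1, [y] is the row itself at time n, and [a], [b] are its jumps. At the boundary,
    [next_half] returns the bookkeeping value [y i], whereas [next_full] starts from the pushed
    position [cap z i (y i)]. *)
Definition next_half (k : nat) (x z y a : nat -> nat) (i : nat) : nat :=
  if boundary k i then y i else maxn (x i) (cap z i (y i) - a i).

Definition next_full (k : nat) (x z x' y a b : nat -> nat) (i : nat) : nat :=
  if boundary k i then
    cap z i (reflect_int (Posz (cap z i (y i)) + Posz (b i) - Posz (a i))%R)
  else cap z i (maxn (next_half k x z y a i) (x' i) + b i).

Lemma position_half a n :
  position a n.*2.+1 = half_step (position a n.*2) (a n.*2.+1).
Proof. by rewrite /= odd_double. Qed.

Lemma position_full a n : position a n.*2.+2 =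
  full_step (position a n.*2.+1) (a n.*2.+1) (a n.*2.+2).
Proof. by rewrite /= odd_double. Qed.

Lemma nth_level a k n i : i < parts k -> nth 0 (level a k n) i = position a n.*2 k i.
Proof. by move=> ip; rewrite (nth_mktuple _ 0 (Ordinal ip)). Qed.

Lemma nth_level0 a k i : nth 0 (level a k 0) i = 0.
Proof.
case: (ltnP i (parts k)) => h; first by rewrite nth_level.
by rewrite nth_default// size_tuple.
Qed.

Lemma nth_half_level0 a k i : nth 0 (half_level a k 0) i = 0.
Proof.
case: (ltnP i (parts k)) => h; last by rewrite nth_default// size_tuple.
exact: (nth_mktuple _ 0 (Ordinal h)).
Qed.

Lemma nth_half_level a k n i : i < parts k -> nth 0 (half_level a k n.+1) i =
  if boundary k i then position a n.*2 k i else position a n.*2.+1 k i.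
Proof. by move=> ip; exact: (nth_mktuple _ 0 (Ordinal ip)). Qed.

(** [half_level] differs from the true position only at the boundary index [k./2], while a site of
    level k+1 looks only at lower indices below [k./2]. *)
Lemma cap_half_level a k n i v : i < parts k.+1 ->
  cap (nth 0 (half_level a k n.+1)) i v = cap (position a n.*2.+1 k) i v.
Proof.
case: i => [//|j]; rewrite partsS ltnS => jk /=.
rewrite nth_half_level; last by rewrite partsE; lia.
by rewrite /boundary (ltn_eqF jk) andbF.
Qed.

Lemma half_level_step a k n i : i < parts k.+1 ->
  nth 0 (half_level a k.+1 n.+1) i =
  next_half k.+1 (nth 0 (level a k n)) (nth 0 (half_level a k n.+1))
    (nth 0 (level a k.+1 n)) (a n.*2.+1 k.+1) i.
Proof.
move=> ip; rewrite nth_half_level// /next_half cap_half_level// nth_level//.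
case: ifPn => // nb; rewrite nth_level; last first.
  by move: nb ip; rewrite /boundary partsS partsE; lia.
by rewrite position_half /= (negPf nb).
Qed.

Lemma level_step a k n i : i < parts k.+1 ->
  nth 0 (level a k.+1 n.+1) i =
  next_full k.+1 (nth 0 (level a k n)) (nth 0 (half_level a k n.+1))
    (nth 0 (level a k n.+1)) (nth 0 (level a k.+1 n))
    (a n.*2.+1 k.+1) (a n.*2.+2 k.+1) i.
Proof.
move=> ip; rewrite /next_full -half_level_step// nth_half_level// !cap_half_level//.
rewrite (nth_level a n.+1 ip) (nth_level a n ip).
rewrite doubleS position_full.
have -> H u v : full_step H u v k.+1 i =
  if boundary k.+1 i then
    cap (H k) i (reflect_int (Posz (H k.+1 i) + Posz (v k.+1 i) - Posz (u k.+1 i))%R)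
  else cap (H k) i (maxn (H k.+1 i) (full_step H u v k i) + v k.+1 i) by [].
case: ifPn => [bi|nb].
  have -> // : position a n.*2.+1 k.+1 i =
      cap (position a n.*2.+1 k) i (position a n.*2 k.+1 i).
  by rewrite !position_half /= bi.
rewrite nth_level ?doubleS ?position_full//.
by move: nb ip; rewrite /boundary partsS partsE; lia.
Qed.

(** The entry [z i] separates neighbouring sites: site i+1 is stopped at [z i], which lies below
    both [x i <= u i] and [x' i]. *)
Lemma next_bounds k (x z x' y a b : nat -> nat) :
  (forall i, i < parts k -> y i.+1 <= x i <= y i) ->
  (forall i, i < k./2 -> x i.+1 <= z i <= x i) ->
  (forall i, i < k./2 -> x' i.+1 <= z i <= x' i) ->
  forall i, i < parts k ->
  let u := next_half k.+1 x z y a in let y' := next_full k.+1 x z x' y a b in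
  [/\ y i.+1 <= u i <= y i, maxn (u i) (x' i) <= y' i &
      i.+1 < parts k.+1 -> y' i.+1 <= minn (u i) (x' i)].
Proof.
move=> Hy Hx Hx' i ip u y'.
have nb : boundary k.+1 i = false.
  by apply/negP; move: ip; rewrite /boundary partsE; lia.
have up : i <= k./2 by move: ip; rewrite partsE; lia.
have xcap : x i <= cap z i (y i) <= y i.
  case: i ip {nb} up => [|j] ip up /=; first by case/andP: (Hy _ ip) => _ ->; rewrite leqnn.
  have /andP[_ h1] := Hy _ ip; have /andP[h2 _] := Hx _ up.
  by rewrite leq_min h1 h2 geq_minl.
have ux : x i <= u i by rewrite /u /next_half nb leq_maxl.
have uc : u i <= cap z i (y i).
  by rewrite /u /next_half nb geq_max leq_subr andbT; case/andP: xcap.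
have /andP[hy1 hy2] := Hy _ ip.
split.
- rewrite (leq_trans hy1)//=; apply: leq_trans uc _; by case/andP: xcap.
- rewrite /y' /next_full nb -/u; move: uc.
  case: i ip {nb xcap ux hy1 hy2} up => [|j] ip up /=; rewrite ?leq_addr//.
  by have /andP[h2 _] := Hx' _ up; rewrite /= => uc; lia.
rewrite partsS ltnS => ik.
have /andP[h1 h2] := Hx _ ik; have /andP[h3 h4] := Hx' _ ik.
have : y' i.+1 <= z i by rewrite /y' /next_full; case: ifP => _ /=; rewrite geq_minr.
by lia.
Qed.

Lemma nth_take_half k (z : (parts k).-tuple nat) i : i < k./2 ->
  nth 0 (take k./2 z) i = nth 0 z i.
Proof. by move=> ik; rewrite nth_take. Qed.

Lemma size_take_half k (z : (parts k).-tuple nat) : size (take k./2 z) = k./2.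
Proof.
by rewrite size_take size_tuple partsE; case: ltnP; lia.
Qed.

Lemma half_interlaceP k (z : (parts k).-tuple nat) (y : seq nat) :
  reflect (forall i, i < k./2 -> nth 0 y i.+1 <= nth 0 z i <= nth 0 y i)
          (interlace (take k./2 z) y).
Proof.
apply: (iffP (interlaceP _ _)); rewrite size_take_half => H i ik;
  by have := H i ik; rewrite nth_take_half.
Qed.

Lemma level_interlaceP k (x : (parts k).-tuple nat) (y : seq nat) :
  reflect (forall i, i < parts k -> nth 0 y i.+1 <= nth 0 x i <= nth 0 y i)
          (interlace x y).
Proof. by apply: (iffP (interlaceP _ _)); rewrite size_tuple. Qed.

(** Induction on time, and at each time on the level: [next_bounds] for level l+1 needs the
    interlacing through the half step on level l. *)
Lemma dynamics_interlace a n k :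
  interlace (level a k n) (level a k.+1 n) /\
  interlace (take k./2 (half_level a k n.+1)) (level a k n) /\
  interlace (take k./2 (half_level a k n.+1)) (level a k n.+1).
Proof.
have H0 l : interlace (level a l 0) (level a l.+1 0).
  by apply/level_interlaceP => i il; rewrite !nth_level0.
have step m : (forall l, interlace (level a l m) (level a l.+1 m)) -> forall l,
  [/\ interlace (take l./2 (half_level a l m.+1)) (level a l m),
      interlace (take l./2 (half_level a l m.+1)) (level a l m.+1) &
      interlace (level a l m.+1) (level a l.+1 m.+1)].
  move=> Hm.
  have main l : interlace (take l./2 (half_level a l m.+1)) (level a l m) ->
      interlace (take l./2 (half_level a l m.+1)) (level a l m.+1) ->
      [/\ interlace (level a l m.+1) (level a l.+1 m.+1),
       interlace (take l.+1./2 (half_level a l.+1 m.+1)) (level a l.+1 m) &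
       interlace (take l.+1./2 (half_level a l.+1 m.+1)) (level a l.+1 m.+1)].
    move=> /half_interlaceP I1 /half_interlaceP I2.
    have /level_interlaceP I0 := Hm l.
    have B := next_bounds (a m.*2.+1 l.+1) (a m.*2.+2 l.+1) I0 I1 I2.
    have ll i : i < parts l -> i < parts l.+1 by rewrite partsS partsE; lia.
    have Y i : i < parts l -> nth 0 (level a l.+1 m.+1) i.+1 <=
       minn (nth 0 (half_level a l.+1 m.+1) i) (nth 0 (level a l m.+1) i).
      move=> il; have [_ _] := B _ il.
      case: (ltnP i.+1 (parts l.+1)) => h; last by move=> _; rewrite nth_default ?size_tuple.
      by move=> /(_ isT); rewrite -(level_step a m h) -(half_level_step a m (ll _ il)).
    split; [apply/level_interlaceP => i il|apply/half_interlaceP => i il..].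
    - have [_] := B _ il; rewrite -(level_step a m (ll _ il)) => h _.
      by have := Y _ il; lia.
    - by have [+ _ _] := B _ il; rewrite -(half_level_step a m (ll _ il)).
    - have [_] := B _ il; rewrite -(level_step a m (ll _ il)) -(half_level_step a m (ll _ il)) => h _.
      by have := Y _ il; lia.
  elim=> [|l [I1 I2 _]].
    have I1 : interlace (take 0./2 (half_level a 0 m.+1)) (level a 0 m).
      by apply/half_interlaceP.
    have I2 : interlace (take 0./2 (half_level a 0 m.+1)) (level a 0 m.+1).
      by apply/half_interlaceP.
    by have [] := main _ I1 I2.
  have [_ J1 J2] := main _ I1 I2.
  by have [J0 _ _] := main _ J1 J2.
have all0 m : forall l, interlace (level a l m) (level a l.+1 m).
  by elim: m => [//|m IH] l; have [] := step _ IH l.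
by split=> //; have [] := step _ (all0 n) k.
Qed.

Lemma half_level_last a k n : odd k ->
  nth 0 (half_level a k n.+1) k./2 = nth 0 (level a k n) k./2.
Proof.
move=> ok; have h : k./2 < parts k by rewrite partsE ok.
by rewrite nth_half_level// nth_level// /boundary ok eqxx.
Qed.

Lemma level_weyl a k n : weyl (level a k n).
Proof.
case: k => [|k].
  by rewrite /weyl /=; have /size0nil -> : size (level a 0 n) = 0 by rewrite size_tuple.
apply: (@interlace_sorted (level a k n)).
  by rewrite !size_tuple partsS partsE; lia.
by have [] := dynamics_interlace a n k.
Qed.

Lemma weyl_half k (z y : (parts k).-tuple nat) :
  interlace (take k./2 z) y -> (odd k -> nth 0 z k./2 = nth 0 y k./2) -> weyl z.
Proof.
move=> /half_interlaceP H zl; apply/(sortedP 0) => i; rewrite size_tuple => ik.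
have ik0 : i.+1 < odd k + k./2 by rewrite -partsE.
have ik' : i < k./2 by lia.
have /andP[h _] := H _ ik'; apply: leq_trans h.
have [ik2|ik2] := ltnP i.+1 k./2; first by case/andP: (H _ ik2).
have [ok e] : odd k /\ i.+1 = k./2 by clear -ik0 ik2; split; lia.
by rewrite e zl.
Qed.

Lemma pair_weyl2 a k n : weyl2 (half_level a k n, level a k n).
Proof.
case: n => [|n].
  split; [|exact: level_weyl|].
    by apply/(sortedP 0) => i _; rewrite !nth_half_level0.
  by apply/(half_interlaceP (half_level a k 0) (level a k 0)) => i ik; rewrite nth_half_level0 !nth_level0.
have [_ [I1 I2]] := dynamics_interlace a n k.
split=> //=; [|exact: level_weyl].
by apply: (weyl_half I1); exact: half_level_last.
Qed.

End DynamicsTheory.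

(** * Laws of a single update *)

Section Weights.
Context {R : realType}.
Variable q : R.

(** The law of max(x, m - xi) at h for a geometric xi: the atom at x carries the whole tail, hence
    no factor [1 - q] there. *)
Definition lower_weight (x m h : nat) : R :=
  (x <= h <= m)%N%:R * (1 - q) ^+ (x < h)%N * q ^+ (m - h).

(** The law of min(z_(i-1), M + xi) at y. The wall z_(i-1) absorbs the tail, and the first particle
    has no wall. *)
Definition upper_weight (z : nat -> nat) (i M y : nat) : R :=
  (M <= y)%N%:R * q ^+ (y - M) *
  (if i is j.+1 then (y <= z j)%N%:R * (1 - q) ^+ (y < z j)%N else 1 - q).

(** The law of the boundary particle at y' after it is pushed from y to min(y, z_(i-1)), moves with
    reflection and is stopped at z_(i-1). The division by [1 - q] at the wall gives the tail of R,
    see [reflected_tail]. *)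
Definition boundary_weight (z : nat -> nat) (i y y' : nat) : R :=
  if i is j.+1 then
    (y' <= z j)%N%:R *
    (if (y' < z j)%N then Rker q (minn y (z j)) y'
     else Rker q (minn y (z j)) y' / (1 - q))
  else Rker q y y'.

Lemma Rker_ge (x y : nat) : (x <= y)%N ->
  Rker q x y = (1 - q) / (1 + q) * (q ^+ (y - x) + q ^+ (x + y).+1).
Proof. by move=> xy; rewrite /Rker distnC distnEl. Qed.

Lemma Rker_le (x y : nat) : (y <= x)%N ->
  Rker q x y = (1 - q) / (1 + q) * (q ^+ (x - y) + q ^+ (x + y).+1).
Proof. by move=> xy; rewrite /Rker distnEl. Qed.

End Weights.

(** * Laws of the half step, the full step and the boundary move *)

Section Geometric.
Context {d : measure_display} {Omega : measurableType d} {R : realType}.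
Variable P : probability Omega R.
Variable q : R.
Hypotheses (q_gt0 : 0 < q) (q_lt1 : q < 1).

Definition geometric_law (X : Omega -> nat) :=
  discrete X /\ forall n, Pr P [set w | X w = n] = (1 - q) * q ^+ n.

Lemma geometric_tail X a : geometric_law X -> Pr P [set w | (a <= X w)%N] = q ^+ a.
Proof.
move=> [mX pX]; elim: a => [|a IH].
  by rewrite expr0 -(PrT P); apply: eq_Pr.
have mle c : measurable [set w | (c <= X w)%N].
  exact: (discrete_preimage (fun n => is_true (c <= n)%N) mX).
have := PrDI P (mle a) (mX a); rewrite IH.
rewrite (_ : Pr P (_ `\` _) = Pr P [set w | (a < X w)%N]); last first.
  apply: eq_Pr => w /=; split=> [[h1 h2]|h]; last by split; lia.
  by rewrite ltn_neqAle h1 andbT; apply/eqP => e; apply: h2.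
rewrite (_ : Pr P (_ `&` _) = Pr P [set w | X w = a]); last first.
  by apply: eq_Pr => w /=; split=> [[]//|->]; split.
rewrite pX exprS => e; rewrite -[LHS](addrK ((1 - q) * q ^+ a)) -e; ring.
Qed.

Lemma lower_law X x m h : geometric_law X -> (x <= m)%N ->
  Pr P [set w | maxn x (m - X w)%N = h] = lower_weight q x m h.
Proof.
move=> gX xm; rewrite /lower_weight.
have [hx|hx] := ltnP h x.
  by rewrite !mul0r -(Pr0 P); apply: eq_Pr => w /=; split=> //; lia.
have [hm|hm] := ltnP m h.
  rewrite /= !mul0r.
  by rewrite -(Pr0 P); apply: eq_Pr => w /=; split=> //; lia.
rewrite mul1r; case: ltngtP hx => // [hx|<-] _.
  rewrite expr1 -(gX.2 (m - h)%N); apply: eq_Pr => w /=; split; lia.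
rewrite expr0 mul1r -(geometric_tail _ gX); apply: eq_Pr => w /=; split; lia.
Qed.

Lemma upper_law X z i M y : geometric_law X ->
  (forall j, i = j.+1 -> (M <= z j)%N) ->
  Pr P [set w | cap z i (M + X w)%N = y] = upper_weight q z i M y.
Proof.
move=> gX; rewrite /upper_weight; case: i => [|j] /= Mz.
  have [My|My] := leqP M y; last first.
    rewrite !mul0r -(Pr0 P); apply: eq_Pr => w /=; split=> //; lia.
  rewrite mul1r mulrC -(gX.2 (y - M)%N); apply: eq_Pr => w /=; split; lia.
have {}Mz := Mz _ erefl.
have [My|My] := leqP M y; last first.
  rewrite !mul0r -(Pr0 P); apply: eq_Pr => w /=; split=> //; lia.
have [yz|yz|yz] := ltngtP y (z j).
- rewrite !mul1r expr1 mulrC -(gX.2 (y - M)%N); apply: eq_Pr => w /=; split; lia.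
- rewrite mul0r mulr0 -(Pr0 P); apply: eq_Pr => w /=; split=> //; lia.
- rewrite !mul1r expr0 mulr1 -(geometric_tail _ gX); apply: eq_Pr => w /=; split; lia.
Qed.

Let mI (A B : Omega -> Prop) : measurable [set w | A w] -> measurable [set w | B w] ->
  measurable [set w | A w /\ B w].
Proof. by move=> mA mB; exact: (measurableI _ _ mA mB). Qed.

Definition geometric_pair (X Y : Omega -> nat) :=
  [/\ discrete X, discrete Y &
    forall a b, Pr P [set w | X w = a /\ Y w = b] = (1 - q) * q ^+ a * ((1 - q) * q ^+ b)].

Lemma geometric_pairC X Y : geometric_pair X Y -> geometric_pair Y X.
Proof.
move=> [mX mY pXY]; split=> // a b; rewrite mulrC -pXY.
by apply: eq_Pr => w /=; split=> -[].
Qed.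

Lemma discrete_pair X Y : geometric_pair X Y -> discrete (fun w => (X w, Y w)).
Proof.
move=> [mX mY _] [a b].
rewrite (_ : mkset _ = [set w | X w = a /\ Y w = b]); first exact: (mI (mX a) (mY b)).
by apply/seteqP; split=> w /= [-> ->].
Qed.

(** Summing over the value of [X] gives a geometric series of ratio q^2, and (1-q)^2 / (1-q^2) =
    (1-q)/(1+q) is the constant of R. *)
Lemma geometric_diff X Y e : geometric_pair X Y ->
  Pr P [set w | Y w = (X w + e)%N] = (1 - q) / (1 + q) * q ^+ e.
Proof.
move=> gXY; have [mX mY pXY] := gXY.
have mE : measurable [set w | Y w = (X w + e)%N].
  exact: (discrete_preimage (fun v => v.2 = (v.1 + e)%N) (discrete_pair gXY)).
apply: EFin_inj; rewrite -PrE// (prob_partition P mX mE).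
pose a := (1 - q) ^+ 2 * q ^+ e; pose z := q ^+ 2.
have zlt : `|z| < 1 by rewrite ger0_norm ?exprn_ge0 ?ltW// expr_lt1// ltW.
rewrite (eq_eseriesr (g := fun n => (a * z ^+ n)%:E)); last first.
  move=> n _; rewrite PrE; last by apply: measurableI => //; exact: mX.
  congr EFin; rewrite (@eq_Pr _ _ _ _ _ [set w | X w = n /\ Y w = (n + e)%N]).
    by rewrite pXY /a /z exprD -exprM mulnC exprM; ring.
  by move=> w /=; split=> [[-> ->]|[-> ->]].
have Hc := cvg_geometric_series (a := a) zlt.
apply/cvg_lim => //.
have -> : (1 - q) / (1 + q) * q ^+ e = a * (1 - z)^-1.
  have h1 : 1 - q != 0 by rewrite subr_eq0 eq_sym lt_eqF.
  have h2 : 1 + q != 0 by rewrite gt_eqF// addr_gt0.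
  have -> : 1 - z = (1 - q) * (1 + q) by rewrite /z; ring.
  by rewrite /a; field; rewrite h1 h2.
rewrite (_ : (fun n => _) = EFin \o series (geometric a z)); last first.
  by apply/funext => n /=; rewrite sumEFin.
by apply: cvg_EFin => //; apply: nearW.
Qed.

Definition reflected m (x y : nat) : nat := reflect_int (Posz m + Posz y - Posz x)%R.

(** The value v has two preimages under the reflection, v and -v-1; these disjoint cases give the
    two terms of R. *)
Lemma reflected_law X Y m v : geometric_pair X Y ->
  Pr P [set w | reflected m (X w) (Y w) = v] = Rker q m v.
Proof.
move=> gXY.
have m2 (Q : nat -> nat -> Prop) : measurable [set w | Q (X w) (Y w)].
  exact: (discrete_preimage (fun v => Q v.1 v.2) (discrete_pair gXY)).
pose B := [set w | X w = (Y w + (m + v).+1)%N].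
have rE w : reflected m (X w) (Y w) = v <->
    (m + Y w = X w + v)%N \/ X w = (Y w + (m + v).+1)%N.
  rewrite /reflected; case e: (_ - _)%R => [n|n] /=; lia.
rewrite (PrDI P (A := [set w | reflected m (X w) (Y w) = v]) (B := B)); first last.
- exact: (m2 (fun x y => x = (y + (m + v).+1)%N)).
- exact: (m2 (fun x y => reflected m x y = v)).
rewrite (@eq_Pr _ _ _ _ (_ `&` _) B); last first.
  by move=> w /=; split=> [[]//|Bw]; split=> //; apply/rE; right.
rewrite /B geometric_diff; last exact: geometric_pairC.
rewrite (@eq_Pr _ _ _ _ (_ `\` _) [set w | (m + Y w = X w + v)%N]); last first.
  move=> w /=; rewrite rE; split=> [[[]//]|h]; split; first by left.
  by lia.

have [mv|vm] := leqP m v.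
  rewrite (@eq_Pr _ _ _ _ _ [set w | Y w = (X w + (v - m))%N]); last first.
    by move=> w /=; split; lia.
  by rewrite geometric_diff// Rker_ge// mulrDr.
rewrite (@eq_Pr _ _ _ _ _ [set w | X w = (Y w + (m - v))%N]); last first.
  by move=> w /=; split; lia.
rewrite geometric_diff; last exact: geometric_pairC.
by rewrite Rker_le ?(ltnW vm)// mulrDr.
Qed.

Lemma q_neq : (q != 0) * (1 - q != 0) * (1 + q != 0).
Proof.
by rewrite !gt_eqF ?subr_gt0// addr_gt0.
Qed.

(** For v >= m, R(m, v) is geometric in v with ratio q, which explains the factor 1/(1-q). The proof
    removes atoms from the total mass starting at 0, so it first needs the closed form [T1] of the
    tails up to m. *)
Lemma reflected_tail X Y m v : geometric_pair X Y -> (m <= v)%N ->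
  Pr P [set w | (v <= reflected m (X w) (Y w))%N] = Rker q m v / (1 - q).
Proof.
move=> gXY mv.
have m2 (Q : nat -> nat -> Prop) : measurable [set w | Q (X w) (Y w)].
  exact: (discrete_preimage (fun v => Q v.1 v.2) (discrete_pair gXY)).
have S u : Pr P [set w | (u < reflected m (X w) (Y w))%N] =
    Pr P [set w | (u <= reflected m (X w) (Y w))%N] - Rker q m u.
  rewrite -(reflected_law m u gXY).
  rewrite [X in _ = X - _](PrDI P (B := [set w | reflected m (X w) (Y w) = u])); first last.
  - exact: (m2 (fun x y => reflected m x y = u)).
  - exact: (m2 (fun x y => (u <= reflected m x y)%N)).
  rewrite [X in _ = _ + X - _](@eq_Pr _ _ _ _ _ [set w | reflected m (X w) (Y w) = u]).
    rewrite addrK; apply: eq_Pr => w /=; split=> [h|[h1 h2]]; first by split; lia.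
    by rewrite ltn_neqAle h1 andbT; apply/eqP => e; apply: h2.
  by move=> w /=; split=> [[]//|->]; split.
have [[q0 q1] q2] := q_neq.
have T1 u : (u <= m)%N -> Pr P [set w | (u <= reflected m (X w) (Y w))%N] =
    1 - (q ^+ (m - u).+1 - q ^+ (m + u).+1) / (1 + q).
  elim: u => [|u IH] um.
    rewrite subn0 addn0 subrr mul0r subr0 -(PrT P); apply: eq_Pr => w; split=> _; first exact: I.
    exact: leq0n.
  rewrite S IH ?(ltnW um)// Rker_le ?(ltnW um)//.
  have -> : (m - u)%N = (m - u.+1).+1 by lia.
  by rewrite addnS !exprS; field; rewrite q2.
elim: v mv => [|v IH] mv.
  have m0 : m = 0%N by lia.
  by rewrite T1// m0 Rker_ge// !subnn !expr0 addn0 expr1; field; rewrite q1 q2.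
move: mv; rewrite leq_eqVlt => /orP[/eqP e|mv].
  by rewrite -e T1// Rker_ge// subnn expr0 expr1 exprS; field; rewrite q1 q2.
rewrite S IH// !Rker_ge ?(ltnW mv)//.
have -> : (v.+1 - m = (v - m).+1)%N by lia.
by rewrite addnS !exprS; field; rewrite q1 q2.
Qed.

Lemma boundary_law X Y z i y y' : geometric_pair X Y ->
  Pr P [set w | cap z i (reflected (cap z i y) (X w) (Y w)) = y'] =
  boundary_weight q z i y y'.
Proof.
move=> gXY; case: i => [|j] /=; first exact: reflected_law.
have [yz|yz|yz] := ltngtP y' (z j).
- rewrite mul1r -(reflected_law _ _ gXY); apply: eq_Pr => w /=; split; lia.
- rewrite mul0r -(Pr0 P); apply: eq_Pr => w /=; split=> //; lia.
rewrite mul1r -(reflected_tail gXY) ?yz ?geq_minr//.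
apply: eq_Pr => w /=; split; lia.
Qed.

End Geometric.

(** * The intertwining identity *)

Section Telescoping.
Context {R : comNzRingType}.

Lemma sum_extend (F : nat -> R) n N : (n <= N)%N ->
  (forall i, (n <= i)%N -> F i = 0) -> \sum_(i < N) F i = \sum_(i < n) F i.
Proof.
move=> nN F0; elim: N nN => [|N IH]; first by rewrite leqn0 => /eqP ->.
rewrite leq_eqVlt => /orP[/eqP -> //|nN].
by rewrite big_ord_recr /= F0 ?addr0 ?IH.
Qed.

(** For a geometric [f] of ratio q, the difference is [(1 - q) * f x]: this is the shape of
    [lower_weight], whose factor [1 - q] is missing at one end. [telescope_up] is the mirror image,
    for [upper_weight]. *)
Lemma telescope_down (f : nat -> R) a h N : (h < N)%N ->
  \sum_(x < N) (a <= x <= h)%N%:R * (if (x < h)%N then f x - f x.+1 else f x) =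
  (a <= h)%N%:R * f a.
Proof.
move=> hN.
rewrite (@sum_extend (fun x => (a <= x <= h)%N%:R * (if (x < h)%N then f x - f x.+1 else f x)) h.+1)//; last first.
  by move=> i hi; rewrite (_ : (a <= i <= h)%N = false) ?mul0r//; lia.
rewrite big_ord_recr /= leqnn andbT ltnn.
rewrite (eq_bigr (fun x : 'I_h => (a <= x)%N%:R * (f x - f x.+1))); last first.
  by move=> x _; rewrite ltn_ord (ltnW (ltn_ord x)) andbT.
have -> : \sum_(x < h) (a <= x)%N%:R * (f x - f x.+1) = (a <= h)%N%:R * (f a - f h).
  elim: h {hN} => [|h IH].
    by rewrite big_ord0 leqn0; case: eqP => [->|_]; rewrite ?subrr ?mulr0 ?mul0r.
  rewrite big_ord_recr /= IH; have [ah|ah|->] := ltngtP a h.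
  - by rewrite (ltnW (leq_trans ah _))// !mul1r addrA subrK.
  - rewrite !mul0r add0r; move: ah; rewrite leq_eqVlt => /orP[/eqP <-|ah].
      by rewrite leqnn subrr mulr0.
    by rewrite leqNgt ah mul0r.
  - by rewrite leqnSn !mul1r subrr add0r.
by rewrite -mulrDr subrK.
Qed.

Lemma telescope_up (g : nat -> R) b m N : (m < N)%N ->
  \sum_(z < N) (b <= z <= m)%N%:R * (if (b < z)%N then g z - g z.-1 else g z) =
  (b <= m)%N%:R * g m.
Proof.
move=> mN.
rewrite (@sum_extend (fun z => (b <= z <= m)%N%:R * (if (b < z)%N then g z - g z.-1 else g z)) m.+1)//; last first.
  by move=> i mi; rewrite (_ : (b <= i <= m)%N = false) ?mul0r//; lia.
rewrite (eq_bigr (fun z : 'I_m.+1 => (b <= z)%N%:R * (if (b < z)%N then g z - g z.-1 else g z))); last first.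
  by move=> z _; rewrite (_ : (z <= m)%N) ?andbT// -ltnS.
elim: m {mN} => [|m IH].
  by rewrite big_ord1.
rewrite big_ord_recr /= IH; have [bm|bm|->] := ltngtP b m.+1.
- by rewrite -ltnS bm !mul1r addrCA subrr addr0.
- by rewrite !mul0r addr0 leqNgt (ltn_trans _ bm)// mul0r.
- by rewrite ltnn mul0r add0r.
Qed.

Lemma prod_indicator n (b : nat -> bool) :
  \prod_(i < n) (b i)%:R = [forall i : 'I_n, b i]%:R :> R.
Proof.
case: forallP => [H|H]; first by rewrite big1// => i _; rewrite H.
have [i bi] : exists i : 'I_n, ~~ b i.
  by apply/existsP; apply: contra_notT H; rewrite negb_exists => /forallP H i;
    have := H i; rewrite negbK.
by rewrite (bigD1 i)//= (negPf bi) mul0r.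
Qed.

End Telescoping.

(** * The intertwining identity, particle by particle *)

Section LocalIdentity.
Context {R : realType}.
Variable q : R.
Hypotheses (q_gt0 : 0 < q) (q_lt1 : q < 1).

(** W_k of the overview, on plain functions so that rows of neighbouring levels can be indexed
    alike. *)
Definition step_weight (k : nat) (y z' y' : nat -> nat) : R :=
  (1 - q) ^+ (k./2).*2 * q ^+ (\sum_(i < k./2) (y i + y' i - 2 * z' i))%N *
  (if odd k then Rker q (y k./2) (y' k./2) * (z' k./2 == y k./2)%:R else 1) *
  [forall i : 'I_(k./2), (y i.+1 <= z' i <= y i)%N && (y' i.+1 <= z' i <= y' i)%N]%:R.

(** The factor of Q_k for one particle: the probability of going from [y i] through [z' i] to [y' i]
    when the lower row is given. *)
Definition site_weight (k : nat) (x z x' y z' y' : nat -> nat) (i : nat) : R :=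
  if boundary k i then (z' i == y i)%:R * boundary_weight q z i (y i) (y' i)
  else lower_weight q (x i) (cap z i (y i)) (z' i) *
       upper_weight q z i (maxn (z' i) (x' i)) (y' i).

Variables (k : nat) (x' y z' y' : nat -> nat).
Let h := parts k.
Let M i := maxn (z' i) (x' i).

(* The part of [site_weight] that depends on the lower level through [z] only. *)
Let psi (z : nat -> nat) (i : nat) : R :=
  if boundary k.+1 i then (z' i == y i)%:R * boundary_weight q z i (y i) (y' i)
  else (z' i <= cap z i (y i))%N%:R * q ^+ (cap z i (y i) - z' i) *
       upper_weight q z i (M i) (y' i).

Let low i (x : nat) : R := (x <= z' i)%N%:R * (1 - q) ^+ (x < z' i)%N.

Let alpha i (x z : nat) : R :=
  ((z <= x)%N && (z <= x' i)%N)%:R * q ^+ (x + x' i - 2 * z).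

(** Collects all factors that involve x_i or z_i: upper site i through x_i, upper site i+1 through
    its wall z_i, and the lower step itself. This shift by one makes the sum over (x, z) a product
    of sums over single pairs. *)
Let kappa i (x z : nat) : R :=
  (y i.+1 <= x)%N%:R * low i x *
  (if (i < k./2)%N then alpha i x z * psi (fun=> z) i.+1
   else Rker q x (x' i) * (z == x)%:R).

Let prod_low (F : nat -> R) :
  \prod_(i < k./2.+1) (if boundary k.+1 i then 1 else F i) = \prod_(i < h) F i.
Proof.
have nb i : (i < k./2)%N -> boundary k.+1 i = false.
  by move=> ik; rewrite /boundary halfS partsE; lia.
rewrite big_ord_recr /=.
rewrite (eq_bigr (fun i : 'I_(k./2) => F i)) => [|i _]; last by rewrite nb.
rewrite /h /boundary halfS partsE /=; case: (odd k) => /=.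
  by rewrite add1n big_ord_recr.
by rewrite add0n eqxx mulr1.
Qed.

Let prod_h (F : nat -> R) :
  \prod_(i < h) F i = (\prod_(i < k./2) F i) * (if odd k then F k./2 else 1).
Proof.
rewrite /h partsE; case: (odd k) => /=; first by rewrite add1n big_ord_recr.
by rewrite add0n mulr1.
Qed.

Lemma site_factor (x z : nat -> nat) :
  x' h = 0%N -> x h = 0%N ->
  [forall i : 'I_h, (y i.+1 <= x i <= y i)%N]%:R * step_weight k x z x' *
  \prod_(i < parts k.+1) site_weight k.+1 x z x' y z' y' i =
  (1 - q) ^+ (k./2).*2 * psi z 0 * \prod_(i < h) kappa i (x i) (z i).
Proof.
move=> x'h xh; rewrite partsS.
pose L := \prod_(i < h) low i (x i).
pose S := \prod_(i < k./2.+1) psi z i.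
have -> : \prod_(i < k./2.+1) site_weight k.+1 x z x' y z' y' i = S * L.
  rewrite /L -(prod_low (fun i => low i (x i))) -big_split /=; apply: eq_bigr => i _.
  rewrite /site_weight /psi /low /lower_weight; case: ifP => _; first by rewrite mulr1.
  by rewrite -mulnb natrM; ring.
have -> : \prod_(i < h) kappa i (x i) (z i) =
   [forall i : 'I_h, (y i.+1 <= x i)%N]%:R * L *
   (\prod_(i < k./2) alpha i (x i) (z i) *
   (if odd k then Rker q (x k./2) (x' k./2) * (z k./2 == x k./2)%:R else 1)) *
   \prod_(i < k./2) psi z i.+1.
  rewrite big_split [X in X * _ = _]big_split /=.
  rewrite (prod_indicator _ (fun i => (y i.+1 <= x i)%N)) -/L.
  rewrite -[RHS]mulrA; congr (_ * _).
  rewrite [LHS](prod_h (fun i => if (i < k./2)%N then alpha i (x i) (z i) * psi (fun=> z i) i.+1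
    else Rker q (x i) (x' i) * (z i == x i)%:R)) ltnn.
  rewrite (eq_bigr (fun i : 'I_(k./2) => alpha i (x i) (z i) * psi z i.+1)); last first.
    by move=> i _; rewrite ltn_ord.
  by rewrite big_split /= -!mulrA; congr (_ * _); rewrite mulrC.
have -> : \prod_(i < k./2) psi z i.+1 = \prod_(i < k./2) psi z (lift ord0 i) by [].
rewrite [RHS](_ : _ = (1 - q) ^+ (k./2).*2 * [forall i : 'I_h, (y i.+1 <= x i)%N]%:R *
  (\prod_(i < k./2) alpha i (x i) (z i) *
   (if odd k then Rker q (x k./2) (x' k./2) * (z k./2 == x k./2)%:R else 1)) * (S * L)); last first.
  by rewrite /S big_ord_recl /=; ring.
(* When the product is nonzero, the interlacing conditions absent from [kappa] follow: x_i <= z'_i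
   <= y_i, and x_(i+1) and x'_(i+1) are at most M_(i+1) <= y'_(i+1) <= z_i. *)
have [->|] := eqVneq (S * L) 0; first by rewrite !mulr0.
rewrite mulf_eq0 negb_or => /andP[/prodf_neq0 Sn /prodf_neq0 Ln].
have xz i : (i < h)%N -> (x i <= z' i)%N.
  by move=> ih; have := Ln (Ordinal ih) isT; rewrite /low /=; case: (leqP (x i) (z' i)) => // _; rewrite mul0r eqxx.
have nb i : (i < h)%N -> boundary k.+1 i = false.
  by rewrite /boundary /h halfS partsE; lia.
have hk i : (i < h)%N -> (i < k./2.+1)%N by rewrite /h partsE; lia.
have ps i : (i < h)%N -> [/\ z' i <= cap z i (y i), M i <= y' i &
     (forall j, i = j.+1 -> y' i <= z j)]%N.
  move=> ih; have := Sn (Ordinal (hk _ ih)) isT; rewrite /psi /= nb// /upper_weight.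
  case: (leqP (z' i) _) => h1; last by rewrite !mul0r eqxx.
  case: (leqP (M i) _) => h2; last by rewrite !mul0r mulr0 eqxx.
  case: i ih h1 h2 => [|j] ih h1 h2; first by split.
  case: (leqP (y' j.+1) _) => h3; last by rewrite !mul0r !mulr0 eqxx.
  by split=> // j' [<-].
have capy i : (cap z i (y i) <= y i)%N by case: i => [|j] //=; rewrite geq_minl.
have -> : [forall i : 'I_h, (y i.+1 <= x i <= y i)%N] = [forall i : 'I_h, (y i.+1 <= x i)%N].
  apply: eq_forallb => i; rewrite (_ : (x i <= y i)%N) ?andbT//.
  have [h1 _ _] := ps _ (ltn_ord i).
  by rewrite (leq_trans (xz _ (ltn_ord i)))// (leq_trans h1).
rewrite /step_weight -prodrXr /alpha [in RHS]big_split /=.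
rewrite (prod_indicator _ (fun i => (z i <= x i)%N && (z i <= x' i)%N)).
have -> : [forall i : 'I_(k./2), (x i.+1 <= z i <= x i)%N && (x' i.+1 <= z i <= x' i)%N] =
          [forall i : 'I_(k./2), (z i <= x i)%N && (z i <= x' i)%N].
  apply: eq_forallb => i.
  have [h1 h2] : (x i.+1 <= z i)%N /\ (x' i.+1 <= z i)%N.
    case: (ltnP i.+1 h) => ih.
      have [a1 a2 /(_ _ erefl) a3] := ps _ ih; have := xz _ ih.
      by move: a1 a2 a3; rewrite /M /=; lia.
    (* This occurs only for even k, where the row beyond its last entry is 0. *)
    have -> : i.+1 = h by have := ltn_ord i; move: ih; rewrite /h partsE; lia.
    by rewrite xh x'h.
  by rewrite h1 h2.
by ring.
Qed.

(** Summing [kappa i] over its pair gives [g i * ee i.+1]: [g i] compares the lower index i with its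
    neighbours, and [ee i.+1] is what remains of upper site i+1 once its wall is summed out. *)
Let g i : R := (y i.+1 <= z' i)%N%:R * (y' i.+1 <= minn (z' i) (x' i))%N%:R *
  q ^+ (M i - z' i).

Let ee i : R := if boundary k.+1 i then (z' i == y i)%:R * (Rker q (y i) (y' i) / (1 - q))
  else (z' i <= y i)%N%:R * q ^+ (y i - z' i) * ((M i <= y' i)%N%:R * q ^+ (y' i - M i)).

Let psi0 z : psi z 0 = (1 - q) * ee 0.
Proof.
have [[q0 q1] q2] := q_neq q_gt0 q_lt1.
rewrite /psi /ee; case: ifP => _ /=; first by field; rewrite q1.
by rewrite /upper_weight; ring.
Qed.

(** As a function of x, [alpha] is geometric from z on, so the sum telescopes to its value at the
    lower end max(z, y_(i+1)). *)
Lemma sum_low_alpha i z N : (z' i < N)%N ->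
  \sum_(x < N) (y i.+1 <= x)%N%:R * low i x * alpha i x z =
  (z <= x' i)%N%:R * (maxn z (y i.+1) <= z' i)%N%:R *
  q ^+ (maxn z (y i.+1) - z + (x' i - z)).
Proof.
move=> zN; pose f x := q ^+ (x - z + (x' i - z)).
have [zx|zx] := leqP z (x' i); last first.
  rewrite !mul0r big1// => x _; rewrite /alpha [in X in _ * X](_ : (z <= x' i)%N = false).
    by rewrite andbF !mul0r mulr0.
  by lia.
rewrite mul1r -(telescope_down f _ zN); apply: eq_bigr => x _.
rewrite /low /alpha zx andbT geq_max.
have [zx'|zx'] := leqP z x; last by rewrite !mul0r mulr0.
rewrite mul1r -mulnb natrM /=; case: (leqP (y i.+1) x) => h1; last by rewrite !mul0r.
rewrite !mul1r; case: ltngtP => h2 //=; rewrite ?mul0r ?mul1r// /f.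
- have -> : (x + x' i - 2 * z = x - z + (x' i - z))%N by lia.
  rewrite expr1 subSn// addSn exprS; ring.
- by congr (_ ^+ _); lia.
Qed.

(** R(w, v) is geometric in w for w >= v. So the power of q left by [sum_low_alpha] exactly undoes
    the push of the boundary particle from w to u. *)
Lemma Rker_shift (u v w : nat) : (v <= u)%N ->
  q ^+ (maxn u w - u) * Rker q (minn w u) v = Rker q w v.
Proof.
move=> vu; have [uw|uw] := leqP w u.
  by rewrite subnn mul1r.
rewrite !Rker_le//; last by lia.
have -> : (w - v = w - u + (u - v))%N by lia.
have -> : ((w + v).+1 = w - u + (u + v).+1)%N by lia.
rewrite !exprD; ring.
Qed.

(** The order matters: for fixed z the sum over x telescopes, and what is left is geometric in z and
    telescopes in turn. *)
Lemma sum_kappa i N : (i < k./2)%N -> (z' i < N)%N ->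
  \sum_(p : 'I_N * 'I_N) kappa i p.1 p.2 = g i * ee i.+1.
Proof.
move=> ik zN; have [[q0 q1] q2] := q_neq q_gt0 q_lt1.
rewrite -(pair_bigA _ (fun a b : 'I_N => kappa i a b)) /= exchange_big /=.
rewrite (eq_bigr (fun z : 'I_N =>
  (z <= x' i)%N%:R * (maxn z (y i.+1) <= z' i)%N%:R *
  q ^+ (maxn z (y i.+1) - z + (x' i - z)) * psi (fun=> z : nat) i.+1)); last first.
  move=> z _; rewrite -(sum_low_alpha z zN) mulr_suml; apply: eq_bigr => x _.
  by rewrite /kappa ik !mulrA.
pose G z := q ^+ (x' i - z); set m := minn (z' i) (x' i).
have mN : (m < N)%N by rewrite /m; lia.
have Gm : q ^+ (M i - z' i) = G m by rewrite /G /m /M; congr (_ ^+ _); lia.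
rewrite /g Gm -/m.
rewrite [RHS](_ : _ = (y i.+1 <= z' i)%N%:R * ee i.+1 * ((y' i.+1 <= m)%N%:R * G m)); last by ring.
rewrite -(telescope_up G (y' i.+1) mN) mulr_sumr; apply: eq_bigr => z _.
(* The factor [1 - q] present only for y' < z comes from the wall of site i+1: it is explicit in
   [upper_weight], and in [boundary_weight] it is the ratio to R / (1 - q). *)
have GE : (if (y' i.+1 < z)%N then G z - G z.-1 else G z) * (z <= x' i)%N%:R =
   (1 - q) ^+ (y' i.+1 < z)%N * G z * (z <= x' i)%N%:R.
  case: (leqP z (x' i)) => h1; last by rewrite !mulr0.
  rewrite !mulr1; case: ltnP => h2; last by rewrite mul1r.
  by rewrite /G (_ : (x' i - z.-1 = (x' i - z).+1)%N) ?exprS ?expr1; [ring|lia].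
have -> : ((y' i.+1 <= z <= m)%N%:R : R) =
    (y' i.+1 <= z)%N%:R * (z <= z' i)%N%:R * (z <= x' i)%N%:R.
  by rewrite -!natrM !mulnb /m leq_min andbA.
rewrite geq_max -mulnb natrM.
rewrite [RHS](_ : _ = (y i.+1 <= z' i)%N%:R * ee i.+1 * ((y' i.+1 <= z)%N%:R * (z <= z' i)%N%:R) *
  ((1 - q) ^+ (y' i.+1 < z)%N * G z * (z <= x' i)%N%:R)); last first.
  by rewrite -GE -!mulrA; do 4!congr (_ * _); rewrite mulrC.
rewrite /psi /ee exprD -/(G z); case: ifP => bi.
  rewrite /boundary_weight.
  case: (leqP (y' i.+1) z) => h1; last by rewrite !mul0r !mulr0 !mul0r.
  rewrite -(Rker_shift (y i.+1) h1).
  case: ltnP => h2; rewrite /=; first by field; rewrite q1.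
  by rewrite expr0; ring.
rewrite /upper_weight /=.
case: (leqP (M i.+1) (y' i.+1)) => h2; last by rewrite !(mul0r, mulr0).
case: (leqP (y' i.+1) z) => h1; last by rewrite !(mul0r, mulr0).
have h4 : (z' i.+1 <= M i.+1)%N by rewrite leq_maxl.
have -> : (z' i.+1 <= minn (y i.+1) z)%N = (z' i.+1 <= y i.+1)%N.
  by rewrite leq_min (leq_trans h4 (leq_trans h2 h1)) andbT.
case: (leqP (z' i.+1) (y i.+1)) => h3; last by rewrite !(mul0r, mulr0).
(* The counterpart of [Rker_shift]: the distance lost by the push to the wall z is the power left by
   the sum over x. *)
have -> : (y i.+1 - z' i.+1 = (maxn z (y i.+1) - z) + (minn (y i.+1) z - z' i.+1))%N.
  by lia.
by rewrite exprD; ring.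
Qed.

(** For X <= n and after division by 1 - q, this says that R(., X) has mass 1, because R is
    symmetric and R(n, X)/(1-q) is the mass of the values at least n. *)
Lemma sum_Rker n X : (1 - q) * (\sum_(x < n) Rker q x X) + Rker q n X =
  (1 - q) * q ^+ (maxn n X - n).
Proof.
have [[q0 q1] q2] := q_neq q_gt0 q_lt1.
elim: n => [|n IH].
  rewrite big_ord0 mulr0 add0r max0n Rker_ge// !subn0 add0n exprS.
  by field; rewrite q2.
rewrite big_ord_recr /= mulrDr.
(* Geometric in n, up to a correction that lives below X. *)
have E : Rker q n.+1 X = q * Rker q n X + (1 - q) * (q ^+ (maxn n.+1 X - n.+1) - q ^+ (maxn n X - n)).
  case: (boolP (X <= n)%N) => [nX|]; last rewrite -ltnNge => nX.
    rewrite !Rker_le//; last by lia.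
    have -> : (maxn n.+1 X - n.+1 = 0)%N by lia.
    have -> : (maxn n X - n = 0)%N by lia.
    have -> : (n.+1 - X = (n - X).+1)%N by lia.
    by rewrite addSn !exprS; field; rewrite q2.
  rewrite !Rker_ge//; last by lia.
  have -> : (maxn n.+1 X - n.+1 = X - n.+1)%N by lia.
  have -> : (maxn n X - n = (X - n.+1).+1)%N by lia.
  have -> : (X - n = (X - n.+1).+1)%N by lia.
  by rewrite addSn !exprS; field; rewrite q2.
rewrite E [LHS](_ : _ = ((1 - q) * (\sum_(x < n) Rker q x X) + Rker q n X) +
  (1 - q) * (q ^+ (maxn n.+1 X - n.+1) - q ^+ (maxn n X - n))); last by ring.
by rewrite IH; ring.
Qed.

(** For odd k the last lower particle is the boundary one: z = x is forced and no upper site lies to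
    its right, so [sum_Rker] replaces the double telescoping. *)
Lemma sum_kappa_last N : odd k -> y h = 0%N -> y' h = 0%N -> (z' k./2 < N)%N ->
  \sum_(p : 'I_N * 'I_N) kappa k./2 p.1 p.2 = (1 - q) * g k./2.
Proof.
move=> ok yh y'h zN; set i := k./2.
have hi : h = i.+1 by rewrite /h partsE ok.
rewrite -(pair_bigA _ (fun a b : 'I_N => kappa i a b)) /=.
rewrite (eq_bigr (fun x : 'I_N => low i x * Rker q x (x' i))); last first.
  move=> x _; rewrite (bigD1 x)//= big1 ?addr0.
    by rewrite /kappa ltnn eqxx -hi yh leq0n mul1r mulr1.
  by move=> z zx; rewrite /kappa ltnn (_ : (z == x :> nat) = false) ?mulr0//; apply/negbTE.
rewrite /g -hi yh y'h !leq0n !mul1r /M -sum_Rker.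
rewrite (@sum_extend _ (fun x => low i x * Rker q x (x' i)) (z' i).+1)//; last first.
  by move=> j hj; rewrite /low leqNgt hj !mul0r.
rewrite big_ord_recr /= /low leqnn ltnn expr0 !mul1r; congr (_ + _).
rewrite mulr_sumr; apply: eq_bigr => x _.
by rewrite (ltn_ord x) (ltnW (ltn_ord x)) mul1r expr1.
Qed.

Definition ffun_fst N (f : {ffun 'I_h -> 'I_N * 'I_N}) (i : nat) : nat :=
  if insub i is Some j then (f j).1 else 0%N.

Definition ffun_snd N (f : {ffun 'I_h -> 'I_N * 'I_N}) (i : nat) : nat :=
  if insub i is Some j then (f j).2 else 0%N.

(** A box bounded by z' suffices: nonzero terms have x_i <= z'_i and z_i <= x_i. *)
Lemma local_identity N :
  x' h = 0%N -> y (parts k.+1) = 0%N -> y' (parts k.+1) = 0%N ->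
  (forall i, (i < h)%N -> (z' i < N)%N) ->
  \sum_(f : {ffun 'I_h -> 'I_N * 'I_N})
    [forall i : 'I_h, (y i.+1 <= ffun_fst f i <= y i)%N]%:R *
    step_weight k (ffun_fst f) (ffun_snd f) x' *
    \prod_(i < parts k.+1) site_weight k.+1 (ffun_fst f) (ffun_snd f) x' y z' y' i =
  step_weight k.+1 y z' y' * [forall i : 'I_h, (y' i.+1 <= x' i <= y' i)%N]%:R.
Proof.
move=> x'h yh y'h zN; have [[q0 q1] q2] := q_neq q_gt0 q_lt1.
transitivity ((1 - q) ^+ (k./2).*2 * ((1 - q) * ee 0) *
   \prod_(i < h) \sum_(p : 'I_N * 'I_N) kappa i p.1 p.2).
  rewrite bigA_distr_bigA mulr_sumr; apply: eq_bigr => f _.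
  rewrite site_factor ?psi0//; last by rewrite /ffun_fst insubF// ltnn.
  congr (_ * _); apply: eq_bigr => i _.
  by rewrite /ffun_fst /ffun_snd insubT//= => hi; rewrite (_ : Sub _ _ = i)//; apply: val_inj.
have -> : \prod_(i < h) \sum_(p : 'I_N * 'I_N) kappa i p.1 p.2 =
  (\prod_(i < k./2) ee i.+1) * (\prod_(i < h) g i) * (if odd k then 1 - q else 1).
  rewrite [LHS](prod_h (fun i => \sum_(p : 'I_N * 'I_N) kappa i p.1 p.2)) (prod_h g).
  rewrite [X in X * _ = _](eq_bigr (fun i : 'I_(k./2) => g i * ee i.+1)); last first.
    by move=> i _; rewrite sum_kappa//; apply: zN; have := ltn_ord i; rewrite /h partsE; lia.
  rewrite big_split /=; case: ifP => ok; last by ring.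
  have hp : h = parts k.+1 by rewrite partsS /h partsE ok.
  rewrite sum_kappa_last ?hp//; first by ring.
  by apply: zN; rewrite /h partsE ok.
have -> : \prod_(i < k./2) ee i.+1 = \prod_(i < k./2) ee (lift ord0 i) by [].
(* One extra power of 1 - q comes from the first upper site, which has no wall, and for odd k
   another from [sum_Rker]. *)
rewrite [LHS](_ : _ = (1 - q) ^+ ((k./2).*2 + 1 + odd k) *
   \prod_(i < k./2.+1) ee i * \prod_(i < h) g i); last first.
  by rewrite big_ord_recl /= !exprD expr1; case: (odd k) => /=; rewrite ?expr1 ?expr0; ring.
have prod_ee : \prod_(i < k./2.+1) ee i =
   (\prod_(i < h) ee i) * (if odd k then 1 else ee h).
  rewrite /h partsE; case: (odd k) => /=; first by rewrite mulr1 add1n.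
  by rewrite add0n big_ord_recr.
rewrite prod_ee.
rewrite [LHS](_ : _ = (1 - q) ^+ ((k./2).*2 + 1 + odd k) * (if odd k then 1 else ee h) *
   \prod_(i < h) (ee i * g i)); last by rewrite [X in _ = _ * X]big_split /=; ring.
have nb i : (i < h)%N -> boundary k.+1 i = false.
  by rewrite /boundary /h halfS partsE; lia.
rewrite (eq_bigr (fun i : 'I_h =>
   ((y i.+1 <= z' i <= y i)%N && (y' i.+1 <= z' i <= y' i)%N)%:R *
   (y' i.+1 <= x' i <= y' i)%N%:R * q ^+ (y i + y' i - 2 * z' i))); last first.
  move=> i _; rewrite /ee /g nb// leq_min /M geq_max -!mulnb !natrM.
  case: (leqP (z' i) (y i)) => h1; last by rewrite !(mul0r, mulr0).
  case: (leqP (z' i) (y' i)) => h2; last by rewrite !(mul0r, mulr0).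
  case: (leqP (x' i) (y' i)) => h3; last by rewrite !(mul0r, mulr0).
  have -> : (y i + y' i - 2 * z' i = (y i - z' i) + ((y' i - maxn (z' i) (x' i)) + (maxn (z' i) (x' i) - z' i)))%N.
    by lia.
  by rewrite !exprD; ring.
rewrite !big_split /= prodrXr.
rewrite (prod_indicator _ (fun i => (y i.+1 <= z' i <= y i)%N && (y' i.+1 <= z' i <= y' i)%N)).
rewrite (prod_indicator _ (fun i => (y' i.+1 <= x' i <= y' i)%N)).
rewrite /step_weight halfS -/h.
(* For even k the surplus power cancels the 1/(1-q) in [ee h], the factor of the boundary particle
   of level k+1. *)
have -> : ((k./2).*2 + 1 + odd k = h.*2 + ~~ odd k)%N by rewrite /h partsE; lia.
rewrite [odd k.+1]/=; case ok: (odd k).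
  by rewrite addn0 /=; ring.
have -> : ee h = (z' h == y h)%:R * (Rker q (y h) (y' h) / (1 - q)).
  by rewrite /ee (_ : boundary k.+1 h)// /boundary halfS eqxx andbT /= ok.
by rewrite addn1 exprS /=; field; rewrite q1.
Qed.

End LocalIdentity.

(** * Branching rule for the dimensions *)

Section Determinants.
Context {F : fieldType}.

(** The coefficient matrix is triangular with unit diagonal, so only the Vandermonde factor
    remains. *)
Lemma det_monic_polys n (p : nat -> {poly F}) (u : nat -> F) :
  (forall j, p j \is monic) -> (forall j, size (p j) = j.+1) ->
  \det (\matrix_(i < n, j < n) (p j).[u i]) =
  \prod_(i < n) \prod_(j < n | (i < j)%N) (u j - u i).
Proof.
move=> pm ps; pose a : 'rV[F]_n := \row_i u i.
have -> : \matrix_(i < n, j < n) (p j).[u i] =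
    (Vandermonde n a)^T *m (\matrix_(m < n, j < n) (p j)`_m).
  apply/matrixP => i j; rewrite !mxE (@horner_coef_wide _ n); last by rewrite ps.
  by apply: eq_bigr => m _; rewrite !mxE mulrC.
rewrite det_mulmx det_tr det_Vandermonde -[\det (\matrix_(m, j) _)]det_tr det_trig.
  rewrite [X in _ * X]big1 ?mulr1.
    by apply: eq_bigr => i _; apply: eq_bigr => j _; rewrite !mxE.
  by move=> i _; rewrite !mxE; have /monicP := pm i; rewrite lead_coefE ps.
by apply/is_trig_mxP => i j ij; rewrite !mxE nth_default// ps.
Qed.

(** Row differences are a unitriangular operation; the vanishing row [n] makes the last row fit the
    pattern. *)
Lemma det_row_diff n (G : nat -> nat -> F) : (forall j, G n j = 0) ->
  \det (\matrix_(i < n, j < n) (G i j - G i.+1 j)) = \det (\matrix_(i < n, j < n) G i j).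
Proof.
move=> Gn.
pose U : 'M[F]_n := \matrix_(i, j) ((i == j)%:R - (i.+1 == j :> nat)%:R).
have -> : \matrix_(i < n, j < n) (G i j - G i.+1 j) = U *m (\matrix_(i < n, j < n) G i j).
  apply/matrixP => i j; rewrite !mxE.
  rewrite (eq_bigr (fun m : 'I_n => (i == m)%:R * G m j - (i.+1 == m :> nat)%:R * G m j)); last first.
    by move=> m _; rewrite !mxE mulrBl.
  rewrite sumrB; congr (_ - _).
    rewrite (bigD1 i)//= eqxx mul1r big1 ?addr0// => m mi.
    by rewrite eq_sym (negPf mi) mul0r.
  case: (ltnP i.+1 n) => h.
    rewrite (bigD1 (Ordinal h))//= eqxx mul1r big1 ?addr0// => m mi.
    rewrite (_ : (i.+1 == m :> nat) = false) ?mul0r//.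
    by apply/negbTE; apply: contraNneq mi => e; apply/eqP/val_inj.
  have -> : i.+1 = n by have := ltn_ord i; lia.
  rewrite Gn big1// => m _; rewrite (_ : (n == m :> nat) = false) ?mul0r//.
  by have := ltn_ord m; lia.
rewrite det_mulmx -[\det U]det_tr det_trig.
  rewrite big1 ?mul1r// => i _; rewrite !mxE eqxx (_ : (i.+1 == i) = false) ?subr0//.
  by lia.
apply/is_trig_mxP => i j ij; rewrite !mxE.
rewrite (_ : (j == i) = false); last by apply/negbTE; rewrite -val_eqE /=; lia.
by rewrite (_ : (j.+1 == i :> nat) = false) ?subr0//; lia.
Qed.

(** Multilinearity in the rows: for given y, the interlacing conditions on the coordinates of x are
    independent, so each row is summed separately. *)
Lemma det_sum_rows n N (a : nat -> nat -> F) (v : nat -> nat -> nat -> F) :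
  \sum_(f : {ffun 'I_n -> 'I_N}) (\prod_(i < n) a i (f i)) *
     \det (\matrix_(i < n, j < n) v i (f i) j) =
  \det (\matrix_(i < n, j < n) \sum_(x < N) a i x * v i x j).
Proof.
rewrite /determinant.
transitivity (\sum_(f : {ffun 'I_n -> 'I_N}) \sum_(s : 'S_n)
   (-1) ^+ s * \prod_(i < n) (a i (f i) * v i (f i) (s i))).
  apply: eq_bigr => f _; rewrite mulr_sumr; apply: eq_bigr => s _.
  rewrite big_split /= mulrCA; congr (_ * (_ * _)).
  by apply: eq_bigr => i _; rewrite mxE.
rewrite exchange_big /=; apply: eq_bigr => s _; rewrite -mulr_sumr; congr (_ * _).
rewrite -(bigA_distr_bigA (fun (i : 'I_n) (x : 'I_N) => a i x * v i x (s i))) /=.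
by apply: eq_bigr => i _; rewrite mxE.
Qed.

End Determinants.

(** * Dimensions as determinants of central factorials *)

Section Dimension.
Context {R : realType}.

(* Central factorials: since their central differences are again central
   factorials, summing a determinant of them over an interlacing pattern
   telescopes. *)
Definition central (m : nat) (l : R) : R :=
  \prod_(t < m) (l + (m%:R - 1) / 2 - t%:R).

Lemma central_diff m l : central m.+1 (l + 2^-1) - central m.+1 (l - 2^-1) =
  m.+1%:R * central m l.
Proof.
rewrite /central big_ord_recl [X in _ - X]big_ord_recr /=.
have -> : \prod_(i < m) (l + 2^-1 + (m.+1%:R - 1) / 2 - (lift ord0 i)%:R) =
          \prod_(t < m) (l + (m%:R - 1) / 2 - t%:R).
  by apply: eq_bigr => i _; rewrite lift0 -!natr1; field.
have -> : \prod_(i < m) (l - 2^-1 + (m.+1%:R - 1) / 2 - i%:R) =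
          \prod_(t < m) (l + (m%:R - 1) / 2 - t%:R).
  by apply: eq_bigr => i _; rewrite -!natr1; field.
by set p := \prod_(t < m) _; rewrite -natr1; field.
Qed.

Lemma centralSS m l : central m.+2 l = central m l * (l ^+ 2 - (m.+1%:R / 2) ^+ 2).
Proof.
rewrite /central big_ord_recl big_ord_recr /=.
have -> : \prod_(i < m) (l + (m.+2%:R - 1) / 2 - (lift ord0 (widen_ord (leqnSn m) i))%:R) =
          \prod_(t < m) (l + (m%:R - 1) / 2 - t%:R).
  by apply: eq_bigr => i _; rewrite lift0 /= -!natr1; field.
by set p := \prod_(t < m) _; rewrite /bump /= -!natr1; field.
Qed.

(** Up to the factor l^e, a central factorial is a monic polynomial in l^2; hence the determinant is
    a Vandermonde product in the l_i^2, as in s_k. *)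
Definition central_poly (e : bool) (j : nat) : {poly R} :=
  \prod_(i < j) ('X - ((((i.*2 + e).+1)%:R / 2) ^+ 2)%:P).

Lemma centralE (e : bool) j l :
  central (j.*2 + e) l = l ^+ e * (central_poly e j).[l ^+ 2].
Proof.
elim: j => [|j IH].
  rewrite /central_poly big_ord0 hornerC mulr1 /central add0n; case: e => /=.
    by rewrite big_ord1 subrr mul0r addr0 subr0 expr1.
  by rewrite big_ord0 expr0.
rewrite doubleS !addSn centralSS IH /central_poly big_ord_recr /= hornerM hornerXsubC.
by rewrite mulrA.
Qed.

Definition central_det (e : bool) (n : nat) (l : nat -> R) : R :=
  \det (\matrix_(i < n, j < n) central (j.*2 + e) (l i)).

Lemma central_detE e n l : central_det e n l =
  (\prod_(i < n) l i ^+ e) *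
  \prod_(i < n) \prod_(j < n | (i < j)%N) (l j ^+ 2 - l i ^+ 2).
Proof.
rewrite /central_det.
have -> : \matrix_(i < n, j < n) central (j.*2 + e) (l i) =
  diag_mx (\row_i l i ^+ e) *m (\matrix_(i < n, j < n) (central_poly e j).[l i ^+ 2]).
  by apply/matrixP => i j; rewrite mul_diag_mx !mxE centralE.
rewrite det_mulmx det_diag (@det_monic_polys _ _ _ (fun i => l i ^+ 2)).
- by congr (_ * _); apply: eq_bigr => i _; rewrite mxE.
- by move=> j; rewrite monic_prod_XsubC.
- by move=> j; rewrite size_prod_XsubC /index_enum -enumT size_enum_ord.
Qed.

(* The shifted coordinates l_i (k even), l'_i (k odd). *)
Definition shifted (k : nat) (y : nat -> nat) (i : nat) : R :=
  (y i + (parts k - i))%:R - (if odd k then 2^-1 else 0).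

(** The numerator of s_k up to sign: odd central factorials for even k produce the product of the
    l_i, even ones for odd k do not. *)
Definition weyl_det (k : nat) (y : nat -> nat) : R :=
  central_det (~~ odd k) (parts k) (shifted k y).

Lemma shifted_gt0 k y i : (i < parts k)%N -> 0 < shifted k y i.
Proof.
move=> ik; rewrite /shifted subr_gt0.
have h : (1 : R) <= (y i + (parts k - i))%:R by rewrite ler1n; lia.
by apply: lt_le_trans h; case: ifP => _; rewrite ?invf_lt1 ?ltr1n.
Qed.

Lemma shifted_lt k y i j : (i < j < parts k)%N -> (y j <= y i)%N ->
  shifted k y j < shifted k y i.
Proof.
by move=> /andP[ij jk] yij; rewrite /shifted ltrD2r ltr_nat; lia.
Qed.

Lemma shifted_sqr k y i j : (i < j < parts k)%N -> (y j <= y i)%N ->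
  0 < shifted k y i ^+ 2 - shifted k y j ^+ 2.
Proof.
move=> ijk yij; have /andP[ij jk] := ijk.
rewrite subr_gt0 ltr_pXn2r// ?nnegrE ?ltW ?shifted_gt0// ?shifted_lt//.
exact: ltn_trans jk.
Qed.

Lemma weyl_det0 k : weyl_det k (fun=> 0%N) != 0.
Proof.
rewrite /weyl_det central_detE mulf_neq0//; apply/prodf_neq0 => i _.
  by rewrite expf_neq0// gt_eqF//; exact: shifted_gt0.
apply/prodf_neq0 => j ij; rewrite -oppr_eq0 opprB gt_eqF//; apply: shifted_sqr => //.
by rewrite ij /=.
Qed.

Lemma sdimE k (lam : seq nat) :
  sdim R k lam = weyl_det k (nth 0%N lam) / weyl_det k (fun=> 0%N).
Proof.
rewrite /weyl_det !central_detE /sdim.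
pose A (y : nat -> nat) : R := \prod_(i < parts k) shifted k y i ^+ ~~ odd k.
pose B (y : nat -> nat) : R := \prod_(i < parts k) \prod_(j < parts k | (i < j)%N)
  (shifted k y j ^+ 2 - shifted k y i ^+ 2).
rewrite -!/(A _) -!/(B _) invfM mulrACA mulrC; congr (_ * _).
  rewrite /A /shifted -prodf_div; case: (odd k) => /=.
    by rewrite big1// => i _; rewrite !expr0 divr1.
  by apply: eq_bigr => i _; rewrite !expr1 add0n.
rewrite /B -prodf_div; apply: eq_bigr => i _; rewrite -prodf_div.
apply: eq_bigr => j _; rewrite -[RHS]divrNN !opprB /shifted /= !add0n.
by case: (odd k).
Qed.

Lemma sdim_gt0 k (lam : seq nat) : size lam = parts k -> sorted geq lam ->
  0 < sdim R k lam.
Proof.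
move=> sl so.
have mono i j : (i < j < parts k)%N -> (nth 0 lam j <= nth 0 lam i)%N.
  move=> /andP[ij jk]; have tr : transitive geq by move=> a b c /= h1 h2; exact: leq_trans h2 h1.
  by apply: (sorted_ltn_nth tr 0%N so i j _ _ ij); rewrite inE sl// (ltn_trans ij).
pose h : R := if odd k then 2^-1 else 0.
have hE y i : (y i + (parts k - i))%:R - h = shifted k y i by [].
rewrite /sdim -/h mulr_gt0//.
  apply: prodr_gt0 => i _; apply: prodr_gt0 => j ij.
  have ijk : (i < j < parts k)%N by rewrite ij ltn_ord.
  apply: divr_gt0; first exact: (shifted_sqr ijk (mono _ _ ijk)).
  by have := @shifted_sqr k (fun=> 0%N) _ _ ijk (leqnn _); rewrite /shifted !add0n.
case: ifP => ok //; apply: prodr_gt0 => i _; apply: divr_gt0.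
  exact: (shifted_gt0 _ (ltn_ord i)).
by have := @shifted_gt0 k (fun=> 0%N) _ (ltn_ord i); rewrite /shifted add0n.
Qed.

Lemma sdim0 k (lam : seq nat) : (forall i, nth 0%N lam i = 0%N) -> sdim R k lam = 1.
Proof.
move=> l0; rewrite sdimE (_ : nth 0%N lam = fun=> 0%N) ?divff ?weyl_det0//.
exact/funext.
Qed.

Lemma sum_central m (c : R) a b N : (a <= b < N)%N ->
  \sum_(x < N) (a <= x <= b)%N%:R * central m (x%:R + c) =
  (central m.+1 (b%:R + c + 2^-1) - central m.+1 (a%:R + c - 2^-1)) / m.+1%:R.
Proof.
move=> /andP[ab bN].
have m0 : m.+1%:R != 0 :> R by rewrite pnatr_eq0.
(* Allowing a = b+1, where both sides vanish, gives a uniform induction on b. *)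
have {ab} : (a <= b.+1)%N by exact: ltnW.
suff -> : \sum_(x < N) (a <= x <= b)%N%:R * central m (x%:R + c) =
  \sum_(x < b.+1) (a <= x)%N%:R * central m (x%:R + c).
  elim: b {bN} => [|b IH] ab.
    rewrite big_ord1 add0r; move: ab; rewrite leq_eqVlt ltnS leqn0.
    case/orP => /eqP -> /=.
      by rewrite mul0r (_ : 1%:R + c - 2^-1 = c + 2^-1) ?subrr ?mul0r//; field.
    by rewrite mul1r add0r central_diff mulrAC divff ?mul1r.
  rewrite big_ord_recr /=; move: ab; rewrite leq_eqVlt => /orP[/eqP ->|ab].
    rewrite ltnn mul0r addr0 big1.
      rewrite (_ : b.+2%:R + c - 2^-1 = b.+1%:R + c + 2^-1) ?subrr ?mul0r//.
      by rewrite -[b.+2%:R]natr1; field.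
    by move=> i _; rewrite leqNgt (ltn_trans (ltn_ord i)) ?mul0r.
  rewrite IH// -ltnS ab mul1r.
  have -> : central m (b.+1%:R + c) = (central m.+1 (b.+1%:R + c + 2^-1) -
     central m.+1 (b.+1%:R + c - 2^-1)) / m.+1%:R.
    by rewrite central_diff mulrAC divff ?mul1r.
  have -> : b%:R + c + 2^-1 = b.+1%:R + c - 2^-1 by rewrite -natr1; field.
  by rewrite -mulrDl addrC addrA subrK.
elim: N bN => [//|N IH]; rewrite ltnS leq_eqVlt => /orP[/eqP ->|bN].
  by apply: eq_bigr => x _; rewrite (_ : (x <= N)%N) ?andbT// -ltnS.
by rewrite big_ord_recr /= IH// (leqNgt N) bN andbF mul0r addr0.
Qed.

Lemma central_odd0 m : odd m -> central m 0 = 0.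
Proof.
move=> om; have -> : m = (m./2).*2 + true by lia.
by rewrite centralE expr1 mul0r.
Qed.

(** The divisors come from summing central factorials and the sign from a column expansion; the
    normalisation of s_k removes both. *)
Let branch_const (k : nat) : R :=
  (\prod_(j < parts k) (j.*2 + ~~ odd k).+1%:R^-1) * (if odd k then 1 else (-1) ^+ parts k).

Let fnat n N (f : {ffun 'I_n -> 'I_N}) (i : nat) : nat :=
  if insub i is Some j then f j else 0%N.

Let fnatE n N (f : {ffun 'I_n -> 'I_N}) (i : 'I_n) : fnat f i = f i.
Proof.
by rewrite /fnat insubT//= => hi; congr (nat_of_ord (f _)); apply: val_inj.
Qed.

(** Summing each row leaves differences of consecutive rows of the next determinant. For odd k the
    sizes agree, and the row beyond the last vanishes because odd central factorials vanish at 0.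
    For even k the size grows by one: the column of constants becomes a unit vector under row
    differences, and expanding along it gives the smaller determinant. *)
Lemma weyl_det_branching k N (y : nat -> nat) :
  (forall i, (i < parts k)%N -> y i.+1 <= y i < N)%N -> y (parts k.+1) = 0%N ->
  \sum_(f : {ffun 'I_(parts k) -> 'I_N})
    [forall i : 'I_(parts k), (y i.+1 <= f i <= y i)%N]%:R * weyl_det k (fnat f) =
  branch_const k * weyl_det k.+1 y.
Proof.
move=> yN yr; set h := parts k; pose e := ~~ odd k.
pose c i : R := (h - i)%:R - (if odd k then 2^-1 else 0).
pose L := shifted k.+1 y.
have step1 : \sum_(f : {ffun 'I_h -> 'I_N})
    [forall i : 'I_h, (y i.+1 <= f i <= y i)%N]%:R * weyl_det k (fnat f) =
  \det (\matrix_(i < h, j < h) \sum_(x < N) (y i.+1 <= x <= y i)%N%:R *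
         central (j.*2 + e) (x%:R + c i)).
  rewrite -(@det_sum_rows _ h N (fun i x => (y i.+1 <= x <= y i)%N%:R)
     (fun i x j => central (j.*2 + e) (x%:R + c i))).
  apply: eq_bigr => f _; congr (_ * _).
    case: forallP => [H|/forallP]; first by rewrite big1// => i _; rewrite H.
    by rewrite negb_forall => /existsP[i /negPf ni]; rewrite (bigD1 i)//= ni mul0r.
  rewrite /weyl_det /central_det; congr (\det _); apply/matrixP => i j.
  by rewrite !mxE /shifted fnatE natrD addrA.
(* The half-unit shifts of the central difference turn the offsets of level k into those of level
   k+1: the upper end y_i gives L_i, the lower end y_(i+1) gives L_(i+1). *)
have cL i b : (i < h)%N -> b%:R + c i + 2^-1 = (b + (parts k.+1 - i))%:R - (if odd k.+1 then 2^-1 else 0).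
  move=> ih; rewrite /c partsS natrD /= -!addrA; congr (_ + _).
  move: ih; rewrite /h partsE; case ok: (odd k) => /= ih.
    by rewrite add1n addNr addr0 subr0.
  by rewrite add0n subSn ?(ltnW ih)// -natr1; field.
have cL' i b : (i < h)%N -> b%:R + c i - 2^-1 = (b + (parts k.+1 - i.+1))%:R - (if odd k.+1 then 2^-1 else 0).
  move=> ih; have := cL _ b ih; rewrite (_ : parts k.+1 - i = (parts k.+1 - i.+1).+1)%N; last first.
    by move: ih; rewrite /h partsS partsE; lia.
  rewrite addnS -natr1 => E.
  rewrite [LHS](_ : _ = b%:R + c i + 2^-1 - 1); last by field.
  by rewrite E; ring.
have step2 : \det (\matrix_(i < h, j < h) \sum_(x < N) (y i.+1 <= x <= y i)%N%:R *
         central (j.*2 + e) (x%:R + c i)) =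
  (\prod_(j < h) (j.*2 + e).+1%:R^-1) *
  \det (\matrix_(i < h, j < h) (central (j.*2 + e).+1 (L i) - central (j.*2 + e).+1 (L i.+1))).
  have -> : \matrix_(i < h, j < h) \sum_(x < N) (y i.+1 <= x <= y i)%N%:R *
         central (j.*2 + e) (x%:R + c i) =
    (\matrix_(i < h, j < h) (central (j.*2 + e).+1 (L i) - central (j.*2 + e).+1 (L i.+1))) *m
    diag_mx (\row_(j < h) (j.*2 + e).+1%:R^-1).
    apply/matrixP => i j; rewrite mul_mx_diag !mxE sum_central; last by apply: yN.
    by rewrite cL// cL'.
  rewrite det_mulmx det_diag mulrC; congr (_ * _).
  by apply: eq_bigr => j _; rewrite mxE.
rewrite step1 step2 /branch_const -/h -/e -mulrA; congr (_ * _).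
rewrite /weyl_det /central_det -/L [odd k.+1]/= negbK.
case ok: (odd k).
  have he : h = parts k.+1 by rewrite /h partsS partsE ok.
  rewrite mul1r -he -(@det_row_diff _ h (fun i j => central (j.*2 + true) (L i))).
    by congr (\det _); apply/matrixP => i j; rewrite !mxE /e ok addn0 addn1.
  move=> j; rewrite /L /shifted he yr subnn addn0 /= ok subr0 central_odd0//.
  by rewrite addn1 /= odd_double.
have he : parts k.+1 = h.+1 by rewrite /h partsS partsE ok.
rewrite he.
pose G i j := if (i < h.+1)%N then central (j.*2 + false) (L i) else 0.
have -> : \matrix_(i < h.+1, j < h.+1) central (j.*2 + false) (L i) =
  \matrix_(i < h.+1, j < h.+1) G i j.
  by apply/matrixP => i j; rewrite !mxE /G ltn_ord.
rewrite -det_row_diff; last by move=> j; rewrite /G ltnn.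
rewrite (expand_det_col _ ord0) (bigD1 ord_max)//= big1 ?addr0; last first.
  move=> i im; rewrite !mxE /G ltn_ord ltnS.
  have -> : (i < h)%N by rewrite ltn_neqAle -ltnS ltn_ord andbT; exact: im.
  by rewrite /central !big_ord0 subrr mul0r.
rewrite !mxE /G ltnSn ltnn /central big_ord0 subr0 mul1r /cofactor /= addn0.
rewrite mulrA -exprD addnn -signr_odd odd_double mul1r.
congr (\det _); apply/matrixP => i j; rewrite !mxE /= /bump.
rewrite (leqNgt h i) ltn_ord /= add0n ltnS (ltnW (ltn_ord i)) ltnS ltn_ord.
by rewrite /e ok !addn0 !addn1 add1n doubleS.
Qed.

Lemma sdim_branching k N (y : seq nat) : size y = parts k.+1 -> sorted geq y ->
  (forall i, (nth 0 y i < N)%N) ->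
  \sum_(f : {ffun 'I_(parts k) -> 'I_N})
    [forall i : 'I_(parts k), (nth 0 y i.+1 <= f i <= nth 0 y i)%N]%:R *
    sdim R k [seq (f i : nat) | i <- enum 'I_(parts k)] = sdim R k.+1 y.
Proof.
move=> sy so yN; set Y := nth 0%N y.
have yr : Y (parts k.+1) = 0%N by rewrite /Y nth_default// sy.
have mono i : (Y i.+1 <= Y i)%N.
  case: (ltnP i.+1 (size y)) => h; last by rewrite /Y nth_default.
  by move/(sortedP 0%N): so => /(_ _ h).
have B := @weyl_det_branching k N Y (fun i _ => introT andP (conj (mono i) (yN i))) yr.
have N0 : (0 < N)%N by exact: leq_ltn_trans (yN 0%N).
(* Below the zero row only the zero row interlaces, which identifies the constant. *)
have B0 : weyl_det k (fun=> 0%N) = branch_const k * weyl_det k.+1 (fun=> 0%N).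
  rewrite -(@weyl_det_branching k N (fun=> 0%N))//.
  rewrite (bigD1 [ffun=> Ordinal N0])//=.
  case: forallP => [_|[] i]; last by rewrite ffunE.
  rewrite mul1r.
  rewrite big1 ?addr0.
    by congr (weyl_det k _); apply/funext => i; rewrite /fnat; case: insub => // j; rewrite ffunE.
  move=> f nf; case: forallP => [H|]; last by rewrite mul0r.
  case/eqP: nf; apply/ffunP => i; apply: val_inj; rewrite ffunE /=.
  by have := H i; rewrite leqn0 => /eqP.
have bn0 : branch_const k != 0.
  by apply: contra_neq (weyl_det0 k) => b0; rewrite B0 b0 mul0r.
rewrite (eq_bigr (fun f : {ffun 'I_(parts k) -> 'I_N} =>
   [forall i : 'I_(parts k), (Y i.+1 <= f i <= Y i)%N]%:R * weyl_det k (fnat f) /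
   weyl_det k (fun=> 0%N))); last first.
  move=> f _; rewrite sdimE mulrA; congr (_ * weyl_det k _ / _).
  apply/funext => i; rewrite /fnat.
  case: insubP => [j ij ji|]; last first.
    by rewrite -leqNgt => ik; rewrite nth_default// size_map size_enum_ord.
  rewrite (nth_map j) ?size_enum_ord//; congr (nat_of_ord (f _)).
  by apply: val_inj; rewrite /= nth_enum_ord.
by rewrite -mulr_suml B sdimE -/Y B0 invfM mulrACA divff// mul1r.
Qed.

End Dimension.

(** * Law of one step of a level *)

Lemma parts_le k : (parts k <= k)%N. Proof. by rewrite partsE; lia. Qed.

Section Step.
Variables (k n : nat) (x z x' y z' y' : nat -> nat).

Definition site_event (i : nat) (a : jumps) : Prop :=
  next_half k.+1 x z y (a n.*2.+1 k.+1) i = z' i /\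
  next_full k.+1 x z x' y (a n.*2.+1 k.+1) (a n.*2.+2 k.+1) i = y' i.

Definition site_dom (i : nat) : pred (nat * nat * nat) :=
  fun t => [&& (n.*2 < t.1.1 <= n.*2.+2)%N, t.1.2 == k.+1 & t.2 == i].

Lemma site_event_depends i : depends (site_dom i) (site_event i).
Proof.
move=> a b ab; rewrite /site_event /next_full /next_half.
have h1 : site_dom i (n.*2.+1, k.+1, i) by apply/and3P; split=> //=; lia.
have h2 : site_dom i (n.*2.+2, k.+1, i) by apply/and3P; split=> //=; lia.
by rewrite (ab _ _ _ h1) (ab _ _ _ h2).
Qed.

Definition step_event (a : jumps) : Prop :=
  forall i, i \in index_iota 0 (parts k.+1) -> site_event i a.

End Step.

Section StepProbability.
Context {d : measure_display} {Omega : measurableType d} {R : realType}.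
Variable P : probability Omega R.
Variable q : R.
Hypotheses (q_gt0 : 0 < q) (q_lt1 : q < 1).
Variable xi : nat -> nat -> nat -> {RV P >-> nat}.
Hypothesis xi_iid : iid_geometric q xi.
Local Notation s := (sample xi).

Let D : set (nat * nat * nat) :=
  [set t | [/\ (0 < t.1.1)%N, (0 < t.1.2)%N & (t.2 < parts t.1.2)%N]].

Definition valid (t : nat * nat * nat) : bool :=
  [&& (0 < t.1.1)%N, (0 < t.1.2)%N & (t.2 < parts t.1.2)%N].

Lemma validP t : valid t -> D t. Proof. by move=> /and3P[]. Qed.

Lemma xi_geometric m j i : valid (m, j, i) -> geometric_law P q (xi m j i).
Proof.
move=> /validP Dt; split; first exact: discrete_xi.
by move=> n; have := xi_iid.2 _ Dt n; rewrite /Pr /= => ->.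
Qed.

Lemma indep_noise (A1 A2 : pred (nat * nat * nat)) N (f1 f2 : jumps -> Prop) :
  (forall t, A1 t -> valid t) -> (forall t, A2 t -> valid t) ->
  (forall t, A1 t -> (t.1.1 < N)%N && (t.1.2 < N)%N) ->
  (forall t, A2 t -> (t.1.1 < N)%N && (t.1.2 < N)%N) ->
  (forall t, A1 t -> ~~ A2 t) ->
  depends A1 f1 -> depends A2 f2 ->
  Pr P [set w | f1 (s w) /\ f2 (s w)] = Pr P [set w | f1 (s w)] * Pr P [set w | f2 (s w)].
Proof.
move=> v1 v2 N1 N2 A12 d1 d2.
have bnd (A : pred _) : (forall t, A t -> valid t) ->
    (forall t, A t -> (t.1.1 < N)%N && (t.1.2 < N)%N) ->
    forall t, A t -> [&& t.1.1 < N, t.1.2 < N & t.2 < N]%N.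
  move=> vA AN t At; have /andP[-> h] := AN t At; rewrite h /=.
  have /and3P[_ _ h'] := vA t At; apply: leq_trans h' _.
  by apply: leq_trans (parts_le _) _; exact: ltnW.
apply: (@Pr_depends _ _ _ _ _ xi_iid.1 A1 A2 N) => //.
- by move=> t /v1 /validP.
- by move=> t /v2 /validP.
- exact: bnd.
- exact: bnd.
Qed.

Lemma xi_pair m m' j i : m != m' -> valid (m, j, i) -> valid (m', j, i) ->
  geometric_pair P q (xi m j i) (xi m' j i).
Proof.
move=> mm' v1 v2; split; try exact: discrete_xi.
move=> a b.
have dep t0 c : depends (pred1 t0) (fun x : jumps => x t0.1.1 t0.1.2 t0.2 = c).
  by case: t0 => -[m0 j0] i0 x y xy; rewrite /= xy//= eqxx.
rewrite -(xi_geometric v1).2 -(xi_geometric v2).2.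
rewrite -(@indep_noise (pred1 (m, j, i)) (pred1 (m', j, i)) (m + m' + j).+1
  (fun x => x m j i = a) (fun x => x m' j i = b)).
- by [].
- by move=> t /= /eqP ->.
- by move=> t /= /eqP ->.
- by move=> t /= /eqP -> /=; lia.
- by move=> t /= /eqP -> /=; lia.
- by move=> t /= /eqP ->; apply: contra mm' => /eqP [->].
- exact: (dep (m, j, i)).
- exact: (dep (m', j, i)).
Qed.

Section Step.
Variables (k n : nat) (x z x' y z' y' : nat -> nat).
Local Notation site_event := (site_event k n x z x' y z' y').
Local Notation site_dom := (site_dom k n).
Local Notation step_event := (step_event k n x z x' y z' y').

Lemma Pr_site i : (i < parts k.+1)%N ->
  (~~ boundary k.+1 i -> (x i <= cap z i (y i))%N) ->
  (forall j, ~~ boundary k.+1 i -> i = j.+1 -> (x' i <= z j)%N) ->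
  Pr P [set w | site_event i (s w)] = site_weight q k.+1 x z x' y z' y' i.
Proof.
move=> ip xc x'z.
have v1 : valid (n.*2.+1, k.+1, i) by rewrite /valid /= ip.
have v2 : valid (n.*2.+2, k.+1, i) by rewrite /valid /= ip.
rewrite /site_event /site_weight /next_full /next_half.
case: ifPn => bi.
  have gp : geometric_pair P q (xi n.*2.+1 k.+1 i) (xi n.*2.+2 k.+1 i).
    by apply: xi_pair => //; lia.
  rewrite -(boundary_law q_gt0 q_lt1 z i (y i) (y' i) gp).
  case: eqP => [->|ne]; last first.
    rewrite mul0r -(Pr0 P); apply: eq_Pr => w /=; split=> // -[e _].
    by apply: ne; rewrite e.
  rewrite mul1r; apply: eq_Pr => w /=; split=> [[]//|h]; by split.
have {}xc := xc bi; have {}x'z := fun j => x'z j bi.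
(* On this event the half step equals [z' i], so the second condition can be written with the second
   jump alone, and independence applies. *)
have -> : Pr P [set w | maxn (x i) (cap z i (y i) - s w n.*2.+1 k.+1 i) = z' i /\
   cap z i (maxn (maxn (x i) (cap z i (y i) - s w n.*2.+1 k.+1 i)) (x' i) +
     s w n.*2.+2 k.+1 i) = y' i] =
  Pr P [set w | maxn (x i) (cap z i (y i) - s w n.*2.+1 k.+1 i) = z' i /\
   cap z i (maxn (z' i) (x' i) + s w n.*2.+2 k.+1 i) = y' i].
  by apply: eq_Pr => w /=; split=> -[h]; rewrite h.
rewrite (@indep_noise (pred1 (n.*2.+1, k.+1, i)) (pred1 (n.*2.+2, k.+1, i)) (n.*2 + k).+4
  (fun a => maxn (x i) (cap z i (y i) - a n.*2.+1 k.+1 i) = z' i)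
  (fun a => cap z i (maxn (z' i) (x' i) + a n.*2.+2 k.+1 i) = y' i)); first last.
- by move=> a b ab; rewrite ab//= eqxx.
- by move=> a b ab; rewrite ab//= eqxx.
- by move=> t /= /eqP ->; apply/negP => /eqP [] ; lia.
- by move=> t /= /eqP -> /=; lia.
- by move=> t /= /eqP -> /=; lia.
- by move=> t /= /eqP ->.
- by move=> t /= /eqP ->.
rewrite (lower_law q_gt0 q_lt1 _ (xi_geometric v1))//.
(* In the remaining case [z' i] lies below the wall, as [upper_law] requires. *)
have [zc|zc] := leqP (z' i) (cap z i (y i)); last first.
  by rewrite /lower_weight (leqNgt (z' i) (cap z i (y i))) zc andbF !mul0r.
congr (_ * _); apply: (upper_law q_gt0 q_lt1 _ (xi_geometric v2)) => j ij.
rewrite geq_max x'z// andbT; move: zc; rewrite ij /= => zc.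
exact: leq_trans zc (geq_minr _ _).
Qed.

Lemma Pr_step :
  (forall i, (i < parts k)%N -> x i <= cap z i (y i))%N ->
  (forall i, (i.+1 < parts k)%N -> (x' i.+1 <= z i)%N) ->
  Pr P [set w | step_event (s w)] =
  \prod_(i < parts k.+1) site_weight q k.+1 x z x' y z' y' i.
Proof.
move=> xc x'z.
have nb i : (i < parts k.+1)%N -> ~~ boundary k.+1 i -> (i < parts k)%N.
  by rewrite /boundary halfS partsS partsE; lia.
rewrite (@Pr_depends_seq _ _ _ _ _ xi_iid.1 _ _ site_dom (n.*2 + k).+4 site_event).
- rewrite -(big_mkord xpredT) /=; apply: eq_big_seq => i; rewrite mem_index_iota /= => ip.
  apply: Pr_site => //; first by move=> bi; apply: xc; exact: nb.
  by move=> j bi ij; rewrite ij; apply: x'z; rewrite -ij; exact: nb.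
- exact: iota_uniq.
- move=> i t; rewrite mem_index_iota /= => ip /and3P[/andP[t1 _] /eqP t2 /eqP t3].
  by apply: validP; rewrite /valid t2 t3 ip (leq_ltn_trans _ t1).
- move=> i t; rewrite mem_index_iota /= => ip /and3P[/andP[_ t1] /eqP -> /eqP ->].
  have := parts_le k.+1; lia.
- by move=> i j t _ _ /and3P[_ _ /eqP <-] /and3P[_ _ /eqP].
- by move=> i _; exact: site_event_depends.
Qed.

End Step.

End StepProbability.

(** * Joint histories of two consecutive levels *)

Local Notation state k := ((parts k).-tuple nat * (parts k).-tuple nat)%type (only parsing).

Definition pair_at (k : nat) (a : jumps) (n : nat) : state k :=
  (half_level a k n, level a k n).

Definition hist (k n : nat) (zeta : nat -> state k) (a : jumps) : Prop :=
  forall m, (m <= n)%N -> pair_at k a m = zeta m.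

Lemma pair_at_depends k n : depends (dom n.*2 k) (fun a => pair_at k a n).
Proof.
by move=> a b ab; rewrite /pair_at (half_level_depends ab) (level_depends ab).
Qed.

Lemma dom_sub M M' K t : (M <= M')%N -> dom M K t -> dom M' K t.
Proof.
move=> MM' /and3P[/andP[h1 h2] h3 h4]; apply/and3P; split=> //.
by rewrite h1 (leq_trans h2).
Qed.

Lemma hist_depends k n zeta : depends (dom n.*2 k) (@hist k n zeta).
Proof.
have H a b : agree (dom n.*2 k) a b -> hist n zeta a -> hist n zeta b.
  move=> ab h m mn; rewrite -(h m mn).
  have dm : depends (dom n.*2 k) (fun a => pair_at k a m).
    by apply: depends_sub (@pair_at_depends k m) => t; apply: dom_sub; rewrite leq_double.
  by rewrite (dm _ _ ab).
move=> a b ab; apply/propext; split; first exact: H.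
by apply: H => m j i h; rewrite ab.
Qed.

Lemma pair_at0 k a b : pair_at k a 0 = pair_at k b 0.
Proof.
rewrite /pair_at; have -> : level a k 0 = level b k 0.
  by apply: eq_from_tnth => i; rewrite !(tnth_nth 0%N) !nth_level0.
by congr (_, _); apply: eq_from_tnth => i; rewrite !(tnth_nth 0%N) !nth_half_level0.
Qed.

Lemma histS k n (zeta : nat -> state k) a :
  hist n.+1 zeta a <-> hist n zeta a /\ pair_at k a n.+1 = zeta n.+1.
Proof.
split=> [h|[h1 h2] m]; first by split=> [m mn|]; apply: h => //; exact: leqW.
by rewrite leq_eqVlt => /orP[/eqP ->//|/h1].
Qed.

Lemma hist_weyl k n (zeta : nat -> state k) a m : hist n zeta a -> (m <= n)%N ->
  weyl (zeta m).2.
Proof. by move=> h /h <-; exact: level_weyl. Qed.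

Definition step_at (k n : nat) (eta : nat -> state k) (zeta : nat -> state k.+1) :
    jumps -> Prop :=
  step_event k n (nth 0%N (eta n).2) (nth 0%N (eta n.+1).1) (nth 0%N (eta n.+1).2)
    (nth 0%N (zeta n).2) (nth 0%N (zeta n.+1).1) (nth 0%N (zeta n.+1).2).

Lemma hist_step k n (eta : nat -> state k) (zeta : nat -> state k.+1) a :
  hist n.+1 eta a -> hist n zeta a ->
  pair_at k.+1 a n.+1 = zeta n.+1 <-> step_at n eta zeta a.
Proof.
move=> he hz; rewrite /step_at.
rewrite -(he n.+1 (leqnn _)) -(he n (leqnSn _)) -(hz n (leqnn _)).
have E (i : nat) : i \in index_iota 0 (parts k.+1) -> (i < parts k.+1)%N.
  by rewrite mem_index_iota.
split=> [<- i /E ip|h].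
  by split; [rewrite -half_level_step|rewrite -level_step].
have mi (i : 'I_(parts k.+1)) : (i : nat) \in index_iota 0 (parts k.+1).
  by rewrite mem_index_iota /=.
have {}h (i : 'I_(parts k.+1)) := h i (mi i).
rewrite [RHS]surjective_pairing; congr (_, _); apply: eq_from_tnth => i;
  rewrite !(tnth_nth 0%N); have [h1 h2] := h i.
  by rewrite -h1 -half_level_step.
by rewrite -h2 -level_step.
Qed.

Definition upper_hist (k n : nat) (eta : nat -> state k) (zeta : nat -> state k.+1)
    (a : jumps) : Prop :=
  pair_at k.+1 (fun _ _ _ => 0%N) 0 = zeta 0%N /\
  forall m, (m < n)%N -> step_at m eta zeta a.

Lemma hist_upper k n (eta : nat -> state k) (zeta : nat -> state k.+1) a :
  hist n eta a -> hist n zeta a <-> upper_hist n eta zeta a.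
Proof.
elim: n => [|n IH] he.
  split=> [h|[h _] m]; first by split=> //; rewrite -(h 0%N)//; exact: pair_at0.
  by rewrite leqn0 => /eqP ->; rewrite -h; exact: pair_at0.
have /histS[he' _] := he.
rewrite histS (IH he'); split=> [[[h0 h1] h2]|[h0 h1]].
  split=> // m; rewrite ltnS leq_eqVlt => /orP[/eqP ->|/h1//].
  by apply/(hist_step he) => //; apply/(IH he').
have h : upper_hist n eta zeta a by split=> // m mn; apply: h1; exact: ltnW.
split=> //; apply/(hist_step he); first by apply/(IH he').
exact: h1.
Qed.

Lemma dom_bound M K t : dom M K t ->
  [&& t.1.1 < (M + K).+2, t.1.2 < (M + K).+2 & t.2 < (M + K).+2]%N.
Proof. by case/and3P=> h1 h2 h3; have := parts_le t.1.2; lia. Qed.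

Section Markov.
Context {d : measure_display} {Omega : measurableType d} {R : realType}.
Variable P : probability Omega R.
Variable q : R.
Hypotheses (q_gt0 : 0 < q) (q_lt1 : q < 1).
Variable xi : nat -> nat -> nat -> {RV P >-> nat}.
Hypothesis xi_iid : iid_geometric q xi.
Local Notation s := (sample xi).

Lemma measurable_dom M K (f : jumps -> Prop) : depends (dom M K) f ->
  measurable [set w | f (s w)].
Proof. exact: (@depends_measurable _ _ _ P xi (dom M K) _ f (@dom_bound M K)). Qed.

Lemma discrete_dom (T : countType) M K (f : jumps -> T) : depends (dom M K) f ->
  discrete (fun w => f (s w)).
Proof. exact: (@depends_discrete _ _ _ P xi T (dom M K) _ f (@dom_bound M K)). Qed.

Lemma step_at_depends k n (eta : nat -> state k) (zeta : nat -> state k.+1) :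
  depends (fun t => [&& (n.*2 < t.1.1 <= n.*2.+2)%N, t.1.2 == k.+1 & (t.2 < parts t.1.2)%N])
    (step_at n eta zeta).
Proof.
move=> a b ab; rewrite /step_at /step_event.
apply: eq_forall => i; apply: eq_forall; rewrite mem_index_iota /= => ip.
apply: site_event_depends => m j l /and3P[/= h1 /eqP h2 /eqP h3].
by apply: ab; apply/and3P; split=> //=; [apply/eqP|rewrite h2 h3].
Qed.

Lemma upper_hist_depends k n (eta : nat -> state k) (zeta : nat -> state k.+1) :
  depends (fun t => [&& (0 < t.1.1 <= n.*2)%N, t.1.2 == k.+1 & (t.2 < parts t.1.2)%N])
    (upper_hist n eta zeta).
Proof.
move=> a b ab; rewrite /upper_hist; congr (_ /\ _).
apply: eq_forall => m; apply: eq_forall => mn.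
apply: step_at_depends => m' j i /and3P[/= h1 h2 h3].
by apply: ab; apply/and3P; split=> //=; lia.
Qed.

Definition product_rule (k : nat) := forall n (eta : nat -> state k),
  Pr P [set w | hist n.+1 eta (s w)] =
  Pr P [set w | hist n eta (s w)] * Sker q (eta n) (eta n.+1).

(** The jumps of level k+1 are independent of level k, and those of the last step are independent of
    the earlier ones. *)
Lemma Pr_joint k n (eta : nat -> state k) (zeta : nat -> state k.+1) :
  product_rule k ->
  Pr P [set w | hist n.+1 eta (s w) /\ hist n.+1 zeta (s w)] =
  Pr P [set w | hist n eta (s w) /\ hist n zeta (s w)] * Sker q (eta n) (eta n.+1) *
  Pr P [set w | step_at n eta zeta (s w)].
Proof.
move=> PR.
have bnd t : dom n.+1.*2 k t -> (t.1.1 < (n.*2 + k).+4)%N && (t.1.2 < (n.*2 + k).+4)%N.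
  by case/and3P => h1 h2 _; lia.
have val t : dom n.+1.*2 k t -> valid t.
  by case/and3P => h1 h2 h3; rewrite /valid h3 andbT; lia.
pose U m t := [&& (0 < t.1.1 <= m.*2)%N, t.1.2 == k.+1 & (t.2 < parts t.1.2)%N].
have I m : (m <= n.+1)%N -> Pr P [set w | hist m eta (s w) /\ hist m zeta (s w)] =
   Pr P [set w | hist m eta (s w)] * Pr P [set w | upper_hist m eta zeta (s w)].
  move=> mn; rewrite -(@indep_noise _ _ _ P q xi xi_iid (dom m.*2 k) (U m) (n.*2 + k).+4
    (hist m eta) (upper_hist m eta zeta)).
  - apply: eq_Pr => w /=; split=> -[h1 h2]; split=> //; first by apply/(hist_upper zeta h1).
    by apply/(hist_upper zeta h1).
  - by move=> t dt; apply: val; apply: dom_sub dt; rewrite leq_double.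
  - by move=> t /and3P[/andP[h0 h1] /eqP h2 h3]; rewrite /valid h3 h2 ?h0 ?(leq_ltn_trans _ h0).
  - by move=> t dt; apply: bnd; apply: dom_sub dt; rewrite leq_double.
  - by case=> -[u v] i /and3P[/= h1 /eqP h2 h3]; rewrite h2 /=; lia.
  - by case=> -[u v] i /and3P[/= _ h2 _]; apply/negP => /and3P[/= _ /eqP h3 _]; lia.
  - exact: hist_depends.
  - exact: upper_hist_depends.
rewrite (I n.+1)// (I n)// PR -!mulrA; congr (_ * _).
rewrite mulrCA; congr (_ * _).
rewrite -(@indep_noise _ _ _ P q xi xi_iid (U n)
  (fun t => [&& (n.*2 < t.1.1 <= n.*2.+2)%N, t.1.2 == k.+1 & (t.2 < parts t.1.2)%N])
  (n.*2 + k).+4 (upper_hist n eta zeta) (step_at n eta zeta)).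
- apply: eq_Pr => w /=; split=> [[h0 h]|[[h0 h1] h2]].
    by split; [split=> // m mn; apply: h; exact: ltnW|exact: h].
  by split=> // m; rewrite ltnS leq_eqVlt => /orP[/eqP ->//|/h1].
- by move=> t /and3P[/andP[h0 h1] /eqP h2 h3]; rewrite /valid h3 h2 ?h0 ?(leq_ltn_trans _ h0).
- by move=> t /and3P[/andP[h0 h1] /eqP h2 h3]; rewrite /valid h3 h2 ?h0 ?(leq_ltn_trans _ h0).
- by case=> -[u v] i /and3P[/= h1 /eqP h2 h3]; rewrite h2 /=; lia.
- by case=> -[u v] i /and3P[/= h1 /eqP h2 h3]; rewrite h2 /=; lia.
- by case=> -[u v] i /and3P[/= h1 _ _]; apply/negP => /and3P[/= h2 _ _]; lia.
- exact: upper_hist_depends.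
- exact: step_at_depends.
Qed.

Lemma SkerE k (u v : state k) : Sker q u v =
  step_weight q k (nth 0%N u.2) (nth 0%N v.1) (nth 0%N v.2) *
  (sdim R k v.2 / sdim R k u.2).
Proof.
case: u v => z y [z' y']; rewrite /Sker /step_weight /weight /=.
have -> : (interlace (take k./2 z') y && interlace (take k./2 z') y') =
  [forall i : 'I_(k./2), (nth 0 y i.+1 <= nth 0 z' i <= nth 0 y i)%N &&
                         (nth 0 y' i.+1 <= nth 0 z' i <= nth 0 y' i)%N].
  apply/andP/forallP => [[/half_interlaceP h1 /half_interlaceP h2] i|h].
    by rewrite h1 ?h2.
  by split; apply/half_interlaceP => i ik; have /andP[] := h (Ordinal ik).
rewrite (eq_bigr (fun i : 'I_(k./2) => nth 0 y i + nth 0 y' i - 2 * nth 0 z' i)%N); last first.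
  by move=> i _; rewrite nth_take.
by case: (odd k) => /=; ring.
Qed.

(** Neither [Sker] nor the upper step reads more of the lower past than its row x at time n, so
    [Pr_joint] may be summed over all lower histories ending at x. The first component of [(x, x)]
    is a dummy. *)
Lemma Pr_level_step k n (zeta : nat -> state k.+1) (x : (parts k).-tuple nat) (u : state k) :
  product_rule k ->
  Pr P [set w | [/\ hist n.+1 zeta (s w), level (s w) k n = x & pair_at k (s w) n.+1 = u]] =
  Sker q (x, x) u *
  Pr P [set w | step_event k n (nth 0%N x) (nth 0%N u.1) (nth 0%N u.2) (nth 0%N (zeta n).2)
     (nth 0%N (zeta n.+1).1) (nth 0%N (zeta n.+1).2) (s w)] *
  Pr P [set w | hist n zeta (s w) /\ level (s w) k n = x].
Proof.
move=> PR; pose V (a : jumps) := [seq pair_at k a m | m <- iota 0 n.+1].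
have dV : depends (dom n.*2 k) V.
  move=> a b ab; apply/eq_in_map => m; rewrite mem_iota add0n ltnS /= => mn.
  apply: (depends_sub _ (@pair_at_depends k m)) ab => t; apply: dom_sub.
  by rewrite leq_double.
have dom_k M t : dom M k t -> dom M k.+1 t.
  by case/and3P => h1 h2 h3; apply/and3P; split=> //; lia.
have mE : measurable [set w | [/\ hist n.+1 zeta (s w), level (s w) k n = x & pair_at k (s w) n.+1 = u]].
  apply: (@measurable_dom n.+1.*2 k.+1 (fun a =>
    [/\ hist n.+1 zeta a, level a k n = x & pair_at k a n.+1 = u])) => a b ab.
  rewrite (hist_depends _ ab) (depends_sub _ (@level_depends k n) ab).
    by rewrite (depends_sub _ (@pair_at_depends k n.+1) ab)// => t; exact: dom_k.
  by move=> t /dom_k; apply: dom_sub; lia.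
have mF : measurable [set w | hist n zeta (s w) /\ level (s w) k n = x].
  apply: (@measurable_dom n.*2 k.+1 (fun a => hist n zeta a /\ level a k n = x)) => a b ab.
  rewrite (hist_depends _ ab) (depends_sub _ (@level_depends k n) ab)//.
  by move=> t; exact: dom_k.
apply: (Pr_scale (discrete_dom dV)) => // v.
(* The default of [nth] makes u the state at time n+1, just past the end of v. *)
pose eta m := nth u v m.
have VE w : size v = n.+1 -> (V (s w) = v <-> hist n eta (s w)).
  move=> sv; split=> [Vv m mn|h].
    by rewrite /eta -Vv (nth_map 0%N) ?size_iota ?ltnS// nth_iota// ltnS.
  apply: (@eq_from_nth _ u); rewrite size_map size_iota ?sv// => i il.
  by rewrite (nth_map 0%N) ?size_iota// nth_iota// add0n h.
have [sv|sv] := eqVneq (size v) n.+1; last first.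
  rewrite (@eq_Pr _ _ _ _ _ set0) ?(@eq_Pr _ _ _ _ (_ `&` _) set0) ?Pr0 ?mulr0//.
    by move=> w /=; split=> // -[_ Vv]; rewrite -Vv size_map size_iota eqxx in sv.
  by move=> w /=; split=> // -[_ Vv]; rewrite -Vv size_map size_iota eqxx in sv.
have [ex|nx] := eqVneq (eta n).2 x; last first.
  rewrite (@eq_Pr _ _ _ _ _ set0) ?(@eq_Pr _ _ _ _ (_ `&` _) set0) ?Pr0 ?mulr0//.
    move=> w /=; split=> // -[[_ lx]] /(VE _ sv) h.
    by rewrite -(h n (leqnn _)) /= lx eqxx in nx.
  move=> w /=; split=> // -[[_ lx _]] /(VE _ sv) h.
  by rewrite -(h n (leqnn _)) /= lx eqxx in nx.
have eS : eta n.+1 = u by rewrite /eta nth_default// sv.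
have -> : Sker q (x, x) u = Sker q (eta n) (eta n.+1) by rewrite eS !SkerE ex.
rewrite [X in _ * Pr P X * _](_ : _ = [set w | step_at n eta zeta (s w)]); last first.
  by rewrite /step_at eS ex.
rewrite (@eq_Pr _ _ _ _ _ [set w | hist n.+1 eta (s w) /\ hist n.+1 zeta (s w)]); last first.
  move=> w /=; split=> [[[h1 h2 h3] /(VE _ sv) h4]|[/histS[h1 h2] h3]].
    by split=> //; apply/histS; rewrite eS.
  split; last exact/(VE _ sv).
  by split=> //; [rewrite -ex -(h1 n (leqnn _))|rewrite h2 eS].
rewrite Pr_joint// -mulrA mulrC; congr (_ * _); apply: eq_Pr => w /=.
split=> [[h1 h2]|[[h1 h2] /(VE _ sv)//]].
by split; [split=> //; rewrite -ex -(h1 n (leqnn _))|exact/(VE _ sv)].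
Qed.

End Markov.

(** * Conditional law of the lower level *)

Lemma nth_le_sumn (l : seq nat) i : (nth 0 l i <= sumn l)%N.
Proof.
elim: l i => [|a l IH] [|i] //=; first by rewrite leq_addr.
by apply: leq_trans (IH i) _; rewrite leq_addl.
Qed.

Lemma interlace_weyl k (x : (parts k).-tuple nat) (y : seq nat) :
  interlace x y -> weyl x.
Proof.
move=> /level_interlaceP H; apply/(sortedP 0%N) => i; rewrite size_tuple => ip.
have /andP[_ h1] := H _ ip; have /andP[h2 _] := H _ (ltnW ip).
exact: leq_trans h1 h2.
Qed.

Lemma interlace_forall k (x : (parts k).-tuple nat) (y : seq nat) :
  [forall i : 'I_(parts k), (nth 0 y i.+1 <= nth 0 x i <= nth 0 y i)%N] = interlace x y.
Proof.
apply/forallP/level_interlaceP => h i; first by move=> ip; exact: (h (Ordinal ip)).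
exact: h.
Qed.

Definition ffun_tuple n N (f : {ffun 'I_n -> 'I_N}) : n.-tuple nat :=
  [tuple (f i : nat) | i < n].

Lemma ffun_tuple_inj n N : injective (@ffun_tuple n N).
Proof.
move=> f g /(congr1 (fun t => tnth t)) fg; apply/ffunP => i; apply: val_inj.
by have := congr1 (fun F => F i) fg; rewrite !tnth_mktuple.
Qed.

Lemma ffun_tuple_mem n N (x : n.-tuple nat) : (forall i, (i < n)%N -> nth 0 x i <= N)%N ->
  x \in [seq ffun_tuple f | f <- enum {: {ffun 'I_n -> 'I_N.+1}}].
Proof.
move=> xN; apply/mapP; exists [ffun i => inord (tnth x i)]; first by rewrite mem_enum.
apply: eq_from_tnth => i; rewrite tnth_mktuple ffunE inordK// ltnS (tnth_nth 0%N).
exact: xN.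
Qed.

Definition ffun_tuple1 n N (f : {ffun 'I_n -> 'I_N * 'I_N}) : n.-tuple nat :=
  [tuple ((f i).1 : nat) | i < n].

Definition ffun_tuple2 n N (f : {ffun 'I_n -> 'I_N * 'I_N}) : n.-tuple nat :=
  [tuple ((f i).2 : nat) | i < n].

Lemma ffun_tuple12_inj n N :
  injective (fun f => (@ffun_tuple1 n N f, @ffun_tuple2 n N f)).
Proof.
move=> f g [fg1 fg2]; apply/ffunP => i.
have e1 : tnth (ffun_tuple1 f) i = tnth (ffun_tuple1 g) i.
  by congr tnth; apply: val_inj.
have e2 : tnth (ffun_tuple2 f) i = tnth (ffun_tuple2 g) i.
  by congr tnth; apply: val_inj.
rewrite !tnth_mktuple in e1 e2.
by rewrite (surjective_pairing (f i)) (surjective_pairing (g i)); congr (_, _); apply: val_inj.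
Qed.

Lemma ffun_tuple12_mem n N (x z : n.-tuple nat) :
  (forall i, (i < n)%N -> (nth 0 x i <= N) && (nth 0 z i <= N))%N ->
  (x, z) \in [seq (ffun_tuple1 f, ffun_tuple2 f) | f <- enum {: {ffun 'I_n -> 'I_N.+1 * 'I_N.+1}}].
Proof.
move=> xN; apply/mapP; exists [ffun i => (inord (tnth x i), inord (tnth z i))].
  by rewrite mem_enum.
congr (_, _); apply: eq_from_tnth => i; rewrite tnth_mktuple ffunE /= inordK// ltnS (tnth_nth 0%N);
  by have /andP[] := xN i (ltn_ord i).
Qed.

Lemma ffun_fstE k N (f : {ffun 'I_(parts k) -> 'I_N * 'I_N}) :
  nth 0%N (ffun_tuple1 f) = ffun_fst f.
Proof.
apply/funext => i; rewrite /ffun_fst; case: insubP => [j ij ji|].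
  by rewrite -ji -tnth_nth tnth_mktuple.
by rewrite -leqNgt => ik; rewrite nth_default ?size_tuple.
Qed.

Lemma ffun_sndE k N (f : {ffun 'I_(parts k) -> 'I_N * 'I_N}) :
  nth 0%N (ffun_tuple2 f) = ffun_snd f.
Proof.
apply/funext => i; rewrite /ffun_snd; case: insubP => [j ij ji|].
  by rewrite -ji -tnth_nth tnth_mktuple.
by rewrite -leqNgt => ik; rewrite nth_default ?size_tuple.
Qed.

Section Gibbs.
Context {d : measure_display} {Omega : measurableType d} {R : realType}.
Variable P : probability Omega R.
Variable q : R.
Hypotheses (q_gt0 : 0 < q) (q_lt1 : q < 1).
Variable xi : nat -> nat -> nat -> {RV P >-> nat}.
Hypothesis xi_iid : iid_geometric q xi.
Local Notation s := (sample xi).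

Lemma step_weight_sorted k (y z' y' : (parts k).-tuple nat) :
  step_weight q k (nth 0%N y) (nth 0%N z') (nth 0%N y') != 0 -> weyl y'.
Proof.
rewrite /step_weight; case: forallP => [H _|]; last by rewrite mulr0 eqxx.
apply: (@interlace_sorted (take k./2 z')).
  by rewrite size_take_half size_tuple partsE; lia.
by apply/half_interlaceP => i ik; have /andP[] := H (Ordinal ik).
Qed.

Lemma weyl_sdim k (y : (parts k).-tuple nat) : weyl y -> 0 < sdim R k y.
Proof. by move=> wy; apply: sdim_gt0 => //; rewrite size_tuple. Qed.

Lemma Pr_hist_weyl k n (zeta : nat -> state k) (F : Omega -> Prop) :
  ~ weyl (zeta n).2 -> Pr P [set w | hist n zeta (s w) /\ F w] = 0.
Proof.
move=> nw; rewrite -(Pr0 P); apply: eq_Pr => w /=; split=> // -[h _].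
by apply: nw; exact: (hist_weyl h (leqnn _)).
Qed.

Definition gibbs k n (zeta : nat -> state k.+1) := forall x : (parts k).-tuple nat,
  Pr P [set w | hist n zeta (s w) /\ level (s w) k n = x] =
  Pr P [set w | hist n zeta (s w)] *
  (sdim R k x / sdim R k.+1 (zeta n).2) * (interlace x (zeta n).2)%:R.

Lemma measurable_hist_level k n (zeta : nat -> state k.+1) x :
  measurable [set w | hist n zeta (s w) /\ level (s w) k n = x].
Proof.
apply: (@measurable_dom _ _ _ P xi n.*2 k.+1 (fun a => hist n zeta a /\ level a k n = x)) => a b ab.
rewrite (hist_depends _ ab) (depends_sub _ (@level_depends k n) ab)// => t.
by case/and3P => h1 h2 h3; apply/and3P; split=> //; lia.
Qed.

Lemma gibbs_step k n (zeta : nat -> state k.+1) (x' : (parts k).-tuple nat) :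
  product_rule q xi k -> gibbs n zeta ->
  Pr P [set w | hist n.+1 zeta (s w) /\ level (s w) k n.+1 = x'] =
  Pr P [set w | hist n zeta (s w)] * (sdim R k x' / sdim R k.+1 (zeta n).2) *
  (step_weight q k.+1 (nth 0%N (zeta n).2) (nth 0%N (zeta n.+1).1) (nth 0%N (zeta n.+1).2) *
   (interlace x' (zeta n.+1).2)%:R).
Proof.
move=> PR G; set y := (zeta n).2; set z' := (zeta n.+1).1; set y' := (zeta n.+1).2.
(* The cancellation needs s_(k+1)(y) to be nonzero; off the Weyl chamber the history has probability
   0. *)
have [wy|nwy] := pselect (weyl y); last first.
  rewrite (@eq_Pr _ _ _ P _ [set w | hist n zeta (s w) /\
    (pair_at k.+1 (s w) n.+1 = zeta n.+1 /\ level (s w) k n.+1 = x')]); last first.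
    by move=> w /=; rewrite histS; tauto.
  rewrite Pr_hist_weyl//.
  rewrite (@eq_Pr _ _ _ P _ [set w | hist n zeta (s w) /\ True]) ?Pr_hist_weyl ?mul0r//.
  by move=> w /=; tauto.
have sy := weyl_sdim wy.
(* The bound by y makes the box contain every (x, z) that can occur, and the bound by z' is the one
   required by [local_identity]. *)
pose N := (sumn y + sumn z')%N.
pose V w := (level (s w) k n, half_level (s w) k n.+1).
pose h := parts k.
have dV : discrete V.
  apply: (@discrete_dom _ _ _ P xi _ n.+1.*2 k (fun a => (level a k n, half_level a k n.+1))).
  move=> a b ab; rewrite (half_level_depends ab) (depends_sub _ (@level_depends k n) ab)// => t.
  by apply: dom_sub; lia.
rewrite (@Pr_finite_partition _ _ _ P _ V
  [seq (ffun_tuple1 f, ffun_tuple2 f) | f <- enum {: {ffun 'I_h -> 'I_N.+1 * 'I_N.+1}}])//; first last.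
- move=> w [hz _]; apply: ffun_tuple12_mem => i ih.
  have [I1 [/half_interlaceP I2 _]] := dynamics_interlace (s w) n k.
  have xy : (nth 0%N (level (s w) k n) i <= N)%N.
    have e : level (s w) k.+1 n = y by rewrite /y -(hz n (leqnSn n)).
    have /level_interlaceP/(_ i ih)/andP[_] := I1; rewrite e => le.
    by apply: leq_trans le (leq_trans (nth_le_sumn _ _) _); rewrite leq_addr.
  rewrite xy /=; move: ih; rewrite /h partsE => ih.
  have [ik|ik] := ltnP i k./2; first by have /andP[_ le] := I2 _ ik; exact: leq_trans le _.
  have [ok e] : odd k /\ i = k./2 by clear -ih ik; split; lia.
  by rewrite e half_level_last// -e.
- by rewrite map_inj_uniq ?enum_uniq//; exact: ffun_tuple12_inj.
- exact: measurable_hist_level.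
rewrite big_map big_enum /= -interlace_forall.
rewrite -(@local_identity _ q q_gt0 q_lt1 k (nth 0%N x') (nth 0%N y) (nth 0%N z') (nth 0%N y') N.+1);
  try by rewrite nth_default// size_tuple.
2: by move=> i _; rewrite ltnS; apply: leq_trans (nth_le_sumn _ _) _; rewrite leq_addl.
rewrite mulr_sumr; apply: eq_bigr => f _.
rewrite -ffun_fstE -ffun_sndE; set x := ffun_tuple1 f; set z := ffun_tuple2 f.
rewrite (eq_forallb (P2 := fun i : 'I_(parts k) => (nth 0 y i.+1 <= nth 0 x i <= nth 0 y i)%N)); last first.
  by move=> i; rewrite -tnth_nth tnth_mktuple.
rewrite interlace_forall.
rewrite (@eq_Pr _ _ _ P _ [set w | [/\ hist n.+1 zeta (s w), level (s w) k n = x &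
    pair_at k (s w) n.+1 = (z, x')]]); last first.
  move=> w; split=> [[[h1 h2] e]|[h1 h2 e]].
    have e1 : level (s w) k n = x := congr1 fst e.
    have e2 : half_level (s w) k n.+1 = z := congr1 snd e.
    by split=> //; rewrite /pair_at e2 h2.
  have e1 : half_level (s w) k n.+1 = z := congr1 fst e.
  have e2 : level (s w) k n.+1 = x' := congr1 snd e.
  by split; [split|rewrite /V; congr (_, _)].
rewrite (Pr_level_step q_gt0 q_lt1 xi_iid _ _ _ _ PR) /= G SkerE /=.
rewrite -/y -/z' -/y'.
case: (boolP (interlace x y)) => [xy|_]; last by rewrite !(mulr0, mul0r).
have sx := weyl_sdim (interlace_weyl xy).
have [->|sw0] := eqVneq (step_weight q k (nth 0%N x) (nth 0%N z) (nth 0%N x')) 0.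
  by rewrite !(mulr0, mul0r).
have H i : (i < k./2)%N -> (nth 0 x i.+1 <= nth 0 z i)%N && (nth 0 x' i.+1 <= nth 0 z i)%N.
  move: sw0; rewrite /step_weight; case: forallP => [H _ ik|]; last by rewrite mulr0 eqxx.
  by have /andP[/andP[-> _] /andP[-> _]] := H (Ordinal ik).
have hk i : (i.+1 < parts k)%N -> (i < k./2)%N by rewrite partsE; lia.
rewrite (Pr_step q_gt0 q_lt1 xi_iid); first last.
- by move=> i /hk /H /andP[].
- move=> i ip; have /level_interlaceP/(_ i ip)/andP[_ le] := xy.
  case: i ip le => [|j] ip le //=; rewrite leq_min le /=.
  by have /andP[] := H _ (hk _ ip).
(* The ratios s(x')/s(x) and s(x)/s(y) multiply to s(x')/s(y), which leaves the sum free of s(x). *)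
by field; rewrite !gt_eqF.
Qed.

(** Sum [gibbs_step] over x': by the branching rule the weights s_k(x') add up to s_(k+1)(y'). *)
Lemma product_rule_of_gibbs k n (zeta : nat -> state k.+1) :
  product_rule q xi k -> gibbs n zeta ->
  Pr P [set w | hist n.+1 zeta (s w)] =
  Pr P [set w | hist n zeta (s w)] * Sker q (zeta n) (zeta n.+1).
Proof.
move=> PR G; rewrite SkerE.
set y := (zeta n).2; set z' := (zeta n.+1).1; set y' := (zeta n.+1).2.
have [wy'|nwy'] := pselect (weyl y'); last first.
  rewrite (@eq_Pr _ _ _ P _ [set w | hist n.+1 zeta (s w) /\ True]) ?Pr_hist_weyl//.
    have [->|/step_weight_sorted//] := eqVneq (step_weight q k.+1 (nth 0%N y) (nth 0%N z') (nth 0%N y')) 0.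
    by rewrite mul0r mulr0.
  by move=> w /=; tauto.
pose N := sumn y'; pose h := parts k.
rewrite (@Pr_finite_partition _ _ _ P _ (fun w => level (s w) k n.+1)
  [seq ffun_tuple f | f <- enum {: {ffun 'I_h -> 'I_N.+1}}])//; first last.
- move=> w hz; apply: ffun_tuple_mem => i ih.
  have e : level (s w) k.+1 n.+1 = y' by rewrite /y' -(hz n.+1 (leqnn _)).
  have [/level_interlaceP/(_ i ih)/andP[_] + _] := dynamics_interlace (s w) n.+1 k.
  rewrite e => le; exact: leq_trans le (nth_le_sumn _ _).
- by rewrite map_inj_uniq ?enum_uniq//; exact: ffun_tuple_inj.
- exact: (@measurable_dom _ _ _ P xi _ _ _ (@hist_depends k.+1 n.+1 zeta)).
- exact: (@discrete_dom _ _ _ P xi _ n.+1.*2 k _ (@level_depends k n.+1)).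
rewrite big_map big_enum /=.
have B := @sdim_branching R k N.+1 y' (size_tuple _) wy' (fun i => nth_le_sumn _ _).
set SW := step_weight _ _ _ _ _; have SWE : SW = step_weight q k.+1 (nth 0%N y) (nth 0%N z') (nth 0%N y') by [].
clearbody SW.
rewrite -B mulr_suml !mulr_sumr; apply: eq_bigr => f _.
rewrite (@eq_Pr _ _ _ P _ [set w | hist n.+1 zeta (s w) /\ level (s w) k n.+1 = ffun_tuple f])//.
rewrite (gibbs_step _ PR G) -/y -/z' -/y' -SWE -interlace_forall.
rewrite (eq_forallb (P2 := fun i : 'I_(parts k) => (nth 0 y' i.+1 <= f i <= nth 0 y' i)%N)); last first.
  by move=> i; rewrite -tnth_nth tnth_mktuple.
have -> : [seq (f i : nat) | i <- enum 'I_(parts k)] = ffun_tuple f by [].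
by ring.
Qed.

(** At time 0 all rows are 0. The inductive step compares [gibbs_step] with its sum over x', so the
    common step weight factors out. *)
Lemma gibbs_all k n (zeta : nat -> state k.+1) : product_rule q xi k -> gibbs n zeta.
Proof.
move=> PR; elim: n => [|n IH] x.
  have H0 w : hist 0 zeta (s w) <-> pair_at k.+1 (fun _ _ _ => 0%N) 0 = zeta 0%N.
    split=> [h|h m]; first by rewrite -(h 0%N (leqnn _)); exact: pair_at0.
    by rewrite leqn0 => /eqP ->; rewrite -h; exact: pair_at0.
  have [e|ne] := pselect (pair_at k.+1 (fun _ _ _ => 0%N) 0 = zeta 0%N); last first.
    rewrite [X in _ = X * _ * _](_ : _ = 0) ?mul0r; last first.
      by rewrite -(Pr0 P); apply: eq_Pr => w /=; split=> // /H0.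
    by rewrite -(Pr0 P); apply: eq_Pr => w /=; split=> // -[/H0].
  have -> : Pr P [set w | hist 0 zeta (s w)] = 1.
    by rewrite -(PrT P); apply: eq_Pr => w; split=> _; [exact: I|exact/H0].
  have y0 i : nth 0%N (zeta 0%N).2 i = 0%N by rewrite -e; exact: nth_level0.
  rewrite (@sdim0 R _ _ y0) divr1 mul1r.
  case: (boolP (interlace x (zeta 0%N).2)) => ix.
    have x0 i : nth 0%N x i = 0%N.
      case: (ltnP i (parts k)) => ip; last by rewrite nth_default// size_tuple.
      by have /level_interlaceP/(_ i ip) := ix; rewrite !y0 leqn0 => /eqP.
    rewrite (@sdim0 R _ _ x0) mulr1 -(PrT P); apply: eq_Pr => w; split=> _; first exact: I.
    split; first exact/H0.
    by apply: eq_from_tnth => i; rewrite !(tnth_nth 0%N) nth_level0 x0.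
  rewrite mulr0 -(Pr0 P); apply: eq_Pr => w; split=> // -[_ lx].
  move/negP: ix; apply; apply/level_interlaceP => i ip.
  by rewrite !y0 -lx nth_level0.
rewrite (gibbs_step _ PR IH) (product_rule_of_gibbs PR IH) SkerE.
set y := (zeta n).2; set z' := (zeta n.+1).1; set y' := (zeta n.+1).2.
have [->|/step_weight_sorted/weyl_sdim sy'] :=
  eqVneq (step_weight q k.+1 (nth 0%N y) (nth 0%N z') (nth 0%N y')) 0.
  by rewrite !(mul0r, mulr0).
have [wy|nwy] := pselect (weyl y); last first.
  rewrite (@eq_Pr _ _ _ P _ [set w | hist n zeta (s w) /\ True]) ?Pr_hist_weyl ?mul0r//.
  by move=> w /=; tauto.
have sy := weyl_sdim wy.
by field; rewrite !gt_eqF.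
Qed.

(** The induction on the level starts at the empty level 0, where all weights are 1. *)
Lemma product_rule_all k : product_rule q xi k.
Proof.
elim: k => [|k IH] n eta; last exact: product_rule_of_gibbs IH (@gibbs_all k n eta IH).
have s0 (u v : (parts 0).-tuple nat) : u = v by apply: eq_from_tnth => -[].
have H m : Pr P [set w | hist m eta (s w)] = 1.
  rewrite -(PrT P); apply: eq_Pr => w; split=> [_|_ j _]; first exact: I.
  by rewrite (surjective_pairing (eta j)) /pair_at; congr (_, _); exact: s0.
rewrite !H mul1r SkerE /step_weight.
have n0 (u : (parts 0).-tuple nat) i : nth 0%N u i = 0%N by rewrite nth_default// size_tuple.
rewrite !(@sdim0 R _ _ (n0 _)) big_ord0 divr1 mulr1.
case: forallP => [_|[] [i i0]]; last by exfalso; rewrite ltn0 in i0.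
by rewrite /= !expr0 !mulr1.
Qed.

End Gibbs.

(** * Markov property *)

Lemma esum_countable {R : realType} (T : countType) (F : T -> \bar R) :
  (forall v, 0 <= F v)%E ->
  (\esum_(v in [set: T]) F v = \sum_(n <oo) (if pickle_inv n is Some v then F v else 0))%E.
Proof.
move=> F0; pose a n := (if @pickle_inv T n is Some v then F v else 0)%E.
rewrite -/(a _) nneseries_esumT; last by move=> n; rewrite /a; case: pickle_inv.
transitivity (\esum_(n in [set @pickle T v | v in setT]) a n)%E.
  rewrite esum_image; last by move=> x y _ _; apply: (pcan_inj pickleK).
  by apply: eq_esum => v _; rewrite /a pickleK_inv.
rewrite esum_mkcond; apply: eq_esum => n _; case: ifPn => // /negP nv; rewrite /a.
have := @pickle_invK T n; case: pickle_inv => //= v vn; case: nv.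
by apply/mem_set; exists v.
Qed.

Section MarkovProcess.
Context {d : measure_display} {Omega : measurableType d} {R : realType}.
Variable P : probability Omega R.

Lemma measurable_path (T : Type) (Z : nat -> Omega -> T) (x : nat -> T) n :
  (forall m, discrete (Z m)) -> measurable [set w | forall m, (m <= n)%N -> Z m w = x m].
Proof.
move=> dZ; elim: n => [|n IH].
  rewrite (_ : mkset _ = [set w | Z 0%N w = x 0%N]); first exact: dZ.
  apply/seteqP; split=> [w h|w h m]; first exact: h.
  by rewrite leqn0 => /eqP ->.
rewrite (_ : mkset _ = [set w | forall m, (m <= n)%N -> Z m w = x m] `&`
   [set w | Z n.+1 w = x n.+1]); first by apply: measurableI => //; exact: dZ.
apply/seteqP; split=> [w h|w [h1 h2] m].
  by split=> [m mn|]; apply: h => //; exact: leqW.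
by rewrite leq_eqVlt => /orP[/eqP ->//|/h1].
Qed.

(* A row of [K] sums to 1 as soon as a point with that row is visited with
   positive probability. *)
Lemma markov_of_product (T : countType) (E : set T) (K : T -> T -> R) (Z : nat -> Omega -> T) :
  (forall x y, E x -> E y -> 0 <= K x y) ->
  (forall n, discrete (Z n)) ->
  (forall n w, E (Z n w)) ->
  (forall n x, Pr P [set w | forall m, (m <= n.+1)%N -> Z m w = x m] =
     Pr P [set w | forall m, (m <= n)%N -> Z m w = x m] * K (x n) (x n.+1)) ->
  (forall y, E y -> exists n x, (forall v, K (x n) v = K y v) /\
     0 < Pr P [set w | forall m, (m <= n)%N -> Z m w = x m]) ->
  markov_process P E K Z.
Proof.
move=> K0 dZ EZ prodK reach; split=> //; last first.
  by move=> n x _; rewrite !PrE ?prodK//; exact: measurable_path.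
split=> // y Ey; have [n [x [xy]]] := reach y Ey.
set H := [set w | _] => Hpos; set c := Pr P H.
have c0 : 0 <= c by exact: ltW.
have mH : measurable H by exact: measurable_path.
have cK v : Pr P (H `&` [set w | Z n.+1 w = v]) = c * K y v.
  pose x' m := if (m <= n)%N then x m else v.
  have := prodK n x'; rewrite {3 4}/x' leqnn ltnn xy => e.
  rewrite (@eq_Pr _ _ _ P _ [set w | forall m, (m <= n.+1)%N -> Z m w = x' m]); last first.
    move=> w /=; split=> [[h1 h2] m|h].
      rewrite leq_eqVlt => /orP[/eqP ->|]; first by rewrite /x' ltnn.
      by rewrite ltnS => mn; rewrite /x' mn; exact: h1.
    split; last by rewrite h// /x' ltnn.
    by move=> m mn; rewrite h ?leqW// /x' mn.
  rewrite e; congr (_ * _); apply: eq_Pr => w /=; rewrite /H /=.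
  by split=> h m mn; rewrite h// /x' mn.
(* States outside [E] are never visited, so the row may be summed over the whole type. *)
have KE v : ~ E v -> K y v = 0.
  move=> nE; have := cK v; rewrite (@eq_Pr _ _ _ P _ set0) ?Pr0.
    by move/esym/eqP; rewrite mulf_eq0 gt_eqF//= => /eqP.
  by move=> w /=; split=> // -[_ e]; apply: nE; rewrite -e.
have Kge v : 0 <= K y v by rewrite -(pmulr_rge0 _ Hpos) -/c -cK Pr_ge0.
rewrite esum_mkcond.
rewrite (_ : (\esum_(v in _) _)%E = (\esum_(v in [set: T]) (K y v)%:E)%E); last first.
  by apply: eq_esum => v _; case: ifPn => // /negP nE; rewrite KE// => Ev; apply: nE; exact: mem_set.
have := prob_partition_esum P (dZ n.+1) mH.
rewrite (eq_esum (b := fun v => (c * K y v)%:E)); last first.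
  by move=> v _; rewrite PrE ?cK//; apply: measurableI => //; exact: dZ.
rewrite PrE// -/c esum_countable => [|v]; last by rewrite lee_fin mulr_ge0.
move=> e; rewrite esum_countable => [|v]; last by rewrite lee_fin.
have -> : (\sum_(m <oo) (if @pickle_inv T m is Some v then (K y v)%:E else 0) =
   \sum_(m <oo) (c^-1)%:E * (if @pickle_inv T m is Some v then (c * K y v)%:E else 0))%E.
  apply: eq_eseriesr => m _; case: pickle_inv => [v|]; last by rewrite mule0.
  by rewrite -EFinM mulKf// gt_eqF.
rewrite nneseriesZl; last by move=> m _; case: pickle_inv => // v; rewrite lee_fin mulr_ge0.
by rewrite -e -EFinM mulVf// gt_eqF.
Qed.

End MarkovProcess.

(** * Reachability of all states, and the passage from S_k to P_k *)

Section Transitions.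
Context {d : measure_display} {Omega : measurableType d} {R : realType}.
Variable P : probability Omega R.
Variable q : R.
Hypotheses (q_gt0 : 0 < q) (q_lt1 : q < 1).
Variable xi : nat -> nat -> nat -> {RV P >-> nat}.
Hypothesis xi_iid : iid_geometric q xi.
Local Notation s := (sample xi).

Lemma Rker_gt0 x y : 0 < Rker q x y.
Proof.
rewrite /Rker mulr_gt0 ?divr_gt0 ?subr_gt0 ?addr_gt0 ?exprn_gt0//.
Qed.

Lemma Sker_ge0 k (u v : state k) : weyl u.2 -> weyl v.2 -> 0 <= Sker q u v.
Proof.
move=> wu wv; rewrite SkerE mulr_ge0//; last by rewrite ltW// divr_gt0// weyl_sdim.
have q1 : 0 <= 1 - q by rewrite subr_ge0 ltW.
have q0 : 0 <= q by exact: ltW.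
rewrite /step_weight; apply: mulr_ge0 => //; apply: mulr_ge0.
  by rewrite mulr_ge0 ?exprn_ge0.
by case: ifP => _ //; rewrite mulr_ge0// ltW// Rker_gt0.
Qed.

Lemma Sker_gt0 k (u v : state k) : weyl u.2 -> weyl v.2 ->
  interlace (take k./2 v.1) u.2 -> interlace (take k./2 v.1) v.2 ->
  (odd k -> nth 0 v.1 k./2 = nth 0 u.2 k./2)%N -> 0 < Sker q u v.
Proof.
move=> wu wv /half_interlaceP i1 /half_interlaceP i2 e.
rewrite SkerE mulr_gt0 ?divr_gt0 ?weyl_sdim//.
have q1 : 0 < 1 - q by rewrite subr_gt0.
rewrite /step_weight; case: forallP => [_|[] i]; last by rewrite i1 ?i2.
rewrite mulr1; apply: mulr_gt0; first by rewrite mulr_gt0 ?exprn_gt0.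
by case: ifP => // /e ->; rewrite eqxx mulr1 Rker_gt0.
Qed.

(** A path to y: at step t the t-th particle jumps straight to its final place. Taking the previous
    row as half step, each transition is allowed by the interlacing. *)
Definition truncation k (y : (parts k).-tuple nat) (t : nat) : (parts k).-tuple nat :=
  [tuple (if (i < t)%N then nth 0%N y i else 0%N) | i < parts k].

Lemma nth_truncation k (y : (parts k).-tuple nat) t i :
  nth 0%N (truncation y t) i = if (i < t)%N then nth 0%N y i else 0%N.
Proof.
case: (ltnP i (parts k)) => ip; first exact: (nth_mktuple _ 0%N (Ordinal ip)).
by rewrite !nth_default ?size_tuple// if_same.
Qed.

Lemma weyl_reachable k (y : (parts k).-tuple nat) : weyl y ->
  exists n (zeta : nat -> state k), (zeta n).2 = y /\ 0 < Pr P [set w | hist n zeta (s w)].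
Proof.
move=> wy; pose zeta t : state k := (truncation y t.-1, truncation y t).
have mono i : (nth 0 y i.+1 <= nth 0 y i)%N.
  case: (ltnP i.+1 (parts k)) => ip; last by rewrite nth_default ?size_tuple.
  by move/(sortedP 0%N): wy => /(_ i); rewrite size_tuple => /(_ ip).
have wt t : weyl (truncation y t).
  apply/(sortedP 0%N) => i _; rewrite /= !nth_truncation.
  case: (ltnP i.+1 t) => [it|//]; by rewrite (ltnW it).
exists (parts k), zeta; split.
  apply: eq_from_tnth => i; rewrite !(tnth_nth 0%N) nth_truncation ltn_ord//.
elim: (parts k) => [|t IH].
  rewrite (_ : Pr P _ = 1)// -(PrT P); apply: eq_Pr => w; split=> _; first exact: I.
  move=> m; rewrite leqn0 => /eqP ->; rewrite /pair_at /zeta; congr (_, _);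
    by apply: eq_from_tnth => i; rewrite !(tnth_nth 0%N) nth_truncation ltn0 ?nth_level0 ?nth_half_level0.
rewrite (product_rule_all q_gt0 q_lt1 xi_iid) mulr_gt0//; apply: Sker_gt0 => //; try exact: wt.
- apply/(half_interlaceP (truncation y t) (truncation y t)) => i _; rewrite !nth_truncation.
  by case: (ltnP i t) => it; case: (ltnP i.+1 t) => it' //=; rewrite ?mono ?leqnn//; lia.
- apply/(half_interlaceP (truncation y t) (truncation y t.+1)) => i _; rewrite !nth_truncation ltnS.
  case: (ltnP i t) => it; first by rewrite ltnS (ltnW it) mono leqnn.
  by rewrite !leq0n.
Qed.

Lemma nth_ffun_tuple n N (f : {ffun 'I_n -> 'I_N}) i (ik : (i < n)%N) :
  nth 0%N (ffun_tuple f) i = f (Ordinal ik).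
Proof. exact: (nth_mktuple _ 0%N (Ordinal ik)). Qed.

(** For odd k, appends the last coordinate of z', which S_k forces to be that of l. *)
Definition extend k (l : (parts k).-tuple nat) (c : (k./2).-tuple nat) : (parts k).-tuple nat :=
  [tuple (if (i < k./2)%N then nth 0%N c i else nth 0%N l i) | i < parts k].

Lemma nth_extend k (l : (parts k).-tuple nat) c i :
  nth 0%N (extend l c) i = if (i < k./2)%N then nth 0%N c i else nth 0%N l i.
Proof.
case: (ltnP i (parts k)) => ip; first exact: (nth_mktuple _ 0%N (Ordinal ip)).
rewrite !nth_default ?size_tuple ?if_same//.
by apply: leq_trans ip; rewrite partsE leq_addl.
Qed.

Lemma take_extend k (l : (parts k).-tuple nat) c : take k./2 (extend l c) = c.
Proof.
apply: (@eq_from_nth _ 0%N); rewrite size_take_half ?size_tuple// => i ik.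
by rewrite nth_take_half// nth_extend ik.
Qed.

Lemma interlace_half_sorted k (l : (parts k).-tuple nat) (c : (k./2).-tuple nat) :
  interlace c l -> sorted geq c.
Proof.
move=> /interlaceP H; apply/(sortedP 0%N) => i ic.
have /andP[_ h1] := H _ ic; have /andP[h2 _] := H _ (ltnW ic).
exact: leq_trans h1 h2.
Qed.

(** P_k is S_k with z' summed out; the condition c <= l keeps the sum finite. *)
Lemma PkerE k (l b : (parts k).-tuple nat) :
  Pker q l b = \sum_(f : {ffun 'I_(k./2) -> 'I_(sumn l).+1})
    Sker q (l, l) (extend l (ffun_tuple f), b).
Proof.
pose A (c : (k./2).-tuple nat) := [&& sorted geq c, interlace c l & interlace c b].
pose r := [seq c <- [seq ffun_tuple f | f <- enum {: {ffun 'I_(k./2) -> 'I_(sumn l).+1}}] | A c].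
rewrite /Pker (@fsbig_fwiden _ _ _ _ r); first last.
- by move=> c [] /=; rewrite mem_filter => /andP[/and3P[h1 h2 h3] _] [].
- by rewrite filter_uniq// map_inj_uniq ?enum_uniq//; exact: ffun_tuple_inj.
- move=> c [h1 h2 h3] /=; rewrite mem_filter /A h1 h2 h3 /=.
  apply: ffun_tuple_mem => i ik; apply: leq_trans (nth_le_sumn l i).
  by have /interlaceP/(_ i) := h2; rewrite size_tuple => /(_ ik)/andP[].
rewrite big_filter big_mkcond big_map big_enum /=; apply: eq_bigr => f _.
rewrite /Sker take_extend /A; set c := ffun_tuple f.
case: (boolP (interlace c l)) => [cl|]; last by rewrite andbF mulr0.
rewrite (interlace_half_sorted cl) !andTb nth_extend ltnn eqxx implybT mulr1.
by case: ifP => _; rewrite ?mulr1 ?mulr0.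
Qed.

Lemma Pker_ge0 k (l b : (parts k).-tuple nat) : weyl l -> weyl b -> 0 <= Pker q l b.
Proof. by move=> wl wb; rewrite PkerE sumr_ge0// => f _; rewrite Sker_ge0. Qed.

(** Since S_k does not read the first component of its source, the last half step can be summed out,
    and then all earlier half steps at once by [Pr_scale]. *)
Lemma level_product k n (x : nat -> (parts k).-tuple nat) :
  Pr P [set w | forall m, (m <= n.+1)%N -> level (s w) k m = x m] =
  Pr P [set w | forall m, (m <= n)%N -> level (s w) k m = x m] * Pker q (x n) (x n.+1).
Proof.
have dlev m : discrete (fun w => level (s w) k m).
  exact: (@discrete_dom _ _ _ P xi _ m.*2 k _ (@level_depends k m)).
have dpair m : discrete (fun w => pair_at k (s w) m).
  exact: (@discrete_dom _ _ _ P xi _ m.*2 k _ (@pair_at_depends k m)).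
have dhalf m : discrete (fun w => half_level (s w) k m).
  exact: (@discrete_dom _ _ _ P xi _ m.*2 k _ (@half_level_depends k m)).
rewrite (@Pr_finite_partition _ _ _ P _ (fun w => half_level (s w) k n.+1)
  [seq extend (x n) (ffun_tuple f) | f <- enum {: {ffun 'I_(k./2) -> 'I_(sumn (x n)).+1}}])//; first last.
- move=> w hx; pose z := half_level (s w) k n.+1.
  have [_ [/half_interlaceP H _]] := dynamics_interlace (s w) n k.
  have e : level (s w) k n = x n by exact: hx.
  apply/mapP; exists [ffun i : 'I_(k./2) => inord (nth 0%N z i)]; first by rewrite mem_enum.
  apply: eq_from_tnth => i; rewrite !(tnth_nth 0%N) nth_extend.
  case: ltnP => ik.
    rewrite (nth_ffun_tuple _ ik) ffunE inordK//= ltnS.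
    apply: leq_trans (nth_le_sumn (x n) i).
    by have /andP[_] := H _ ik; rewrite e.
  have [ok ei] : odd k /\ i = k./2 :> nat.
    by have := ltn_ord i; rewrite [X in (_ < X)%N]partsE; clear -ik; split; lia.
  by rewrite ei half_level_last// e.
- rewrite map_inj_uniq ?enum_uniq// => f g fg; apply: ffun_tuple_inj.
  apply: eq_from_tnth => i; rewrite !(tnth_nth 0%N).
  by have := congr1 (fun u : (parts k).-tuple nat => nth 0%N u i) fg; rewrite !nth_extend ltn_ord.
- exact: measurable_path.
rewrite big_map big_enum /= PkerE mulr_sumr; apply: eq_bigr => f _.
set z := extend _ _; rewrite mulrC.
pose V (a : jumps) := [seq pair_at k a m | m <- iota 0 n.+1].
apply: (@Pr_scale _ _ _ P _ (fun w => V (s w))).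
- apply: (@discrete_dom _ _ _ P xi _ n.*2 k V).
  move=> a b ab; apply/eq_in_map => m; rewrite mem_iota add0n ltnS /= => mn.
  apply: (depends_sub _ (@pair_at_depends k m)) ab => t; apply: dom_sub.
  by rewrite leq_double.
- by apply: measurableI; [exact: measurable_path|exact: dhalf].
- exact: measurable_path.
move=> v; pose u : state k := (z, x n.+1); pose eta m := nth u v m.
have VE w : size v = n.+1 -> (V (s w) = v <-> hist n eta (s w)).
  move=> sv; split=> [Vv m mn|h].
    by rewrite /eta -Vv (nth_map 0%N) ?size_iota ?ltnS// nth_iota// ltnS.
  apply: (@eq_from_nth _ u); rewrite size_map size_iota ?sv// => i il.
  by rewrite (nth_map 0%N) ?size_iota// nth_iota// add0n h.
have [sv|sv] := eqVneq (size v) n.+1; last first.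
  rewrite (@eq_Pr _ _ _ _ _ set0) ?(@eq_Pr _ _ _ _ (_ `&` _) set0) ?Pr0 ?mulr0//.
    by move=> w /=; split=> // -[_ Vv]; rewrite -Vv size_map size_iota eqxx in sv.
  by move=> w /=; split=> // -[_ Vv]; rewrite -Vv size_map size_iota eqxx in sv.
have [ex|nx] := pselect (forall m, (m <= n)%N -> (eta m).2 = x m); last first.
  rewrite (@eq_Pr _ _ _ _ _ set0) ?(@eq_Pr _ _ _ _ (_ `&` _) set0) ?Pr0 ?mulr0//.
    move=> w /=; split=> // -[lx] /(VE _ sv) h; apply: nx => m mn.
    by rewrite -(h m mn); exact: lx.
  move=> w /=; split=> // -[[lx _]] /(VE _ sv) h; apply: nx => m mn.
  by rewrite -(h m mn); apply: lx; exact: leqW.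
have eS : eta n.+1 = u by rewrite /eta nth_default// sv.
have -> : Sker q (x n, x n) u = Sker q (eta n) (eta n.+1) by rewrite eS !SkerE ex.
rewrite (@eq_Pr _ _ _ _ _ [set w | hist n.+1 eta (s w)]); last first.
  move=> w; split=> [[[h1 h2] /(VE _ sv) h3]|/histS[h1 h2]].
    by apply/histS; split=> //; rewrite eS /pair_at h2 h1.
  have e1 : half_level (s w) k n.+1 = z by have := congr1 fst h2; rewrite eS.
  have e2 : level (s w) k n.+1 = x n.+1 by have := congr1 snd h2; rewrite eS.
  split; last exact/(VE _ sv).
  split=> // m; rewrite leq_eqVlt => /orP[/eqP ->//|]; rewrite ltnS => mn.
  by rewrite -ex// -(h1 m mn).
rewrite (product_rule_all q_gt0 q_lt1 xi_iid) mulrC; congr (_ * _); apply: eq_Pr => w.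
split=> [h|[_ /(VE _ sv)//]]; split; last exact/(VE _ sv).
by move=> m mn; rewrite -ex// -(h m mn).
Qed.

End Transitions.

Theorem theorem4p1 (R : realType) (d : measure_display)
    (Omega : measurableType d) (P : probability Omega R) (q : R)
    (q_gt0 : 0 < q) (q_lt1 : q < 1)
    (xi : nat -> nat -> nat -> {RV P >-> nat})
    (xi_iid : iid_geometric q xi) (k : nat) (k_ge1 : (1 <= k)%N) :
  let noise (w : Omega) : nat -> nat -> nat -> nat := fun m j i => xi m j i w in
  markov_process P (@weyl2 k) (@Sker R q k)
    (fun n w => (half_level (noise w) k n, level (noise w) k n)) /\
  markov_process P (@weyl k) (@Pker R q k)
    (fun n w => level (noise w) k n).
Proof.
split.
  apply: markov_of_product.
  - by move=> u v [_ wu _] [_ wv _]; exact: Sker_ge0.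
  - by move=> n; exact: (@discrete_dom _ _ _ P xi _ n.*2 k _ (@pair_at_depends k n)).
  - by move=> n w; exact: pair_weyl2.
  - by move=> n x; exact: (product_rule_all q_gt0 q_lt1 xi_iid).
  (* A state with the same second component as u has the same row, so u itself need not be
     visited. *)
  move=> u [_ wu _]; have [n [zeta [e pos]]] := weyl_reachable q_gt0 q_lt1 xi_iid wu.
  by exists n, zeta; split=> // v; rewrite !SkerE e.
apply: markov_of_product.
- by move=> l b wl wb; exact: Pker_ge0.
- by move=> n; exact: (@discrete_dom _ _ _ P xi _ n.*2 k _ (@level_depends k n)).
- by move=> n w; exact: level_weyl.
- by move=> n x; exact: (level_product q_gt0 q_lt1 xi_iid).
move=> y wy; have [n [zeta [e pos]]] := weyl_reachable q_gt0 q_lt1 xi_iid wy.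
exists n, (fun m => (zeta m).2); split=> [v|]; first by rewrite e.
(* The history of pairs is contained in the history of its second components. *)
apply: lt_le_trans pos _; apply: fine_le; rewrite ?fin_num_measure//.
- exact: (@measurable_dom _ _ _ P xi _ _ _ (@hist_depends k n zeta)).
- apply: measurable_path => m.
  exact: (@discrete_dom _ _ _ P xi _ m.*2 k _ (@level_depends k m)).
apply: le_measure; rewrite ?inE.
- exact: (@measurable_dom _ _ _ P xi _ _ _ (@hist_depends k n zeta)).
- apply: measurable_path => m.
  exact: (@discrete_dom _ _ _ P xi _ m.*2 k _ (@level_depends k m)).
by move=> w h m mn; rewrite -(h m mn).
Qed.
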